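(* The range of the weighted Cauchy transform on $L^2_\mu$ decomposes as $$\mathcal{C}_\mu(L^2_\mu) = \bigoplus_{\ell\in\mathbb{Z}} E_\ell,$$ the direct sum being the orthogonal Hilbertian direct sum in $L^2_\mu$.
   Context: Let $d\mu = e^{-|z|^2}\,dx\,dy$ on $\mathbb{C}$ and let $L^2_\mu = L^2(\mathbb{C},d\mu)$ be the Hilbert space with scalar product $\langle f,g\rangle = \int_{\mathbb{C}} f\,\overline{g}\,d\mu$. The weighted Cauchy transform is the bounded operator on $L^2_\mu$ given by $$\mathcal{C}_\mu f(z) = \frac1\pi\int_{\mathbb{C}} \frac{f(\xi)}{z-\xi}\,d\mu(\xi).$$ For nonnegative integers $m,n$, the Itô–Hermite polynomials are $$H_{m,n}(z,\bar z) = \frac{(-1)^m n!}{(n-m)!}\,\bar z^{\,n-m}\,{}_1F_1(-m;\,n-m+1;\,|z|^2)\quad (m\le n),$$ $$H_{m,n}(z,\bar z) = \frac{(-1)^n m!}{(m-n)!}\, z^{m-n}\,{}_1F_1(-n;\,m-n+1;\,|z|^2)\quad (m\ge n),$$ where ${}_1F_1$ is Kummer's confluent hypergeometric function; they form an orthogonal basis of $L^2_\mu$. Put $\psi_{m,n}=\mathcal{C}_\mu H_{m,n}\in L^2_\mu$. For a nonnegative integer $j$ set $$E_j^+=\overline{\mathrm{span}\{\psi_{n,n+j}: n=0,1,2,\dots\}},\qquad E_j^-=\overline{\mathrm{span}\{\psi_{n+j,n}: n=0,1,2,\dots\}},$$ closures being taken in $L^2_\mu$. For $\ell\in\mathbb{Z}$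 set $E_\ell=E^+_{|\ell|}$ if $\ell\ge 0$ and $E_\ell=E^-_{|\ell|}$ if $\ell<0$.
   Formalization: The range of the weighted Cauchy transform is replaced by its closure in L²_μ: the range itself is not closed (1_{1<|z|<2}/z lies in E_0 but is not a weighted Cauchy transform), so the literal equality with the closed Hilbertian sum is false. *)

(* Defs.v *)
From HB Require Import structures.
From mathcomp Require Import all_boot all_order all_algebra finmap.
From mathcomp Require Import complex.
From mathcomp Require Import all_classical all_reals all_analysis.
From mathcomp Require Import measurable_realfun.

Set Implicit Arguments.
Unset Strict Implicit.
Unset Printing Implicit Defensive.

Import Order.TTheory GRing.Theory Num.Theory.
Import numFieldNormedType.Exports.

Local Open Scope classical_set_scope.
Local Open Scope ring_scope.
Local Open Scope complex_scope.

(* The complex plane as a measurable space: (x, y) stands for x + iy. *)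
Definition plane (R : realType) := (measurableTypeR R * measurableTypeR R)%type.

Definition toC (R : realType) (z : plane R) : R[i] := z.1 +i* z.2.

Definition sqmod (R : realType) (z : plane R) : R := z.1 ^+ 2 + z.2 ^+ 2.

Definition area (R : realType) : {measure set (plane R) -> \bar R} :=
  (@lebesgue_measure R \x @lebesgue_measure R)%E.

Definition gauss (R : realType) (A : set (plane R)) : \bar R :=
  (\int[area R]_(z in A) (expR (- sqmod z))%:E)%E.

Section gauss_measure.
Context (R : realType).

Lemma measurable_sqmod : measurable_fun [set: plane R] (@sqmod R).
Proof.
by apply: measurable_funD; apply: measurable_funX;
  [exact: measurable_fst | exact: measurable_snd].
Qed.

Let mexp : measurable_fun [set: plane R]
  (fun z : plane R => (expR (- sqmod z))%:E).
Proof.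
apply/measurable_EFinP; apply: measurableT_comp; first exact: measurable_expR.
by apply: measurable_funN; exact: measurable_sqmod.
Qed.

Let gauss0 : gauss set0 = 0%E :> \bar R.
Proof. by rewrite /gauss integral_set0. Qed.

Let gauss_ge0 (A : set (plane R)) : (0 <= gauss A)%E.
Proof. by apply: integral_ge0 => z _; rewrite lee_fin expR_ge0. Qed.

Let gauss_sigma_additive : semi_sigma_additive (@gauss R).
Proof.
move=> F mF tF mUF; rewrite /gauss ge0_integral_bigcup//.
- by apply: is_cvg_ereal_nneg_natsum_cond => n _ _; exact: gauss_ge0.
- exact: measurable_funTS.
Qed.

HB.instance Definition _ := isMeasure.Build _ _ _ (@gauss R)
  gauss0 gauss_ge0 gauss_sigma_additive.

End gauss_measure.

(* Elements of L^2_mu are represented by functions.  [L2closure], [hilbert_sum]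
   and [cauchy_range] yield subsets of [L2] stable under mu-a.e. equality, so
   equality of such sets is equality of subsets of L^2_mu. *)
Section L2mu.
Context (R : realType).
Implicit Types f g : plane R -> R[i].

Definition cintegral f : R[i] :=
  (\int[@gauss R]_z complex.Re (f z)) +i* (\int[@gauss R]_z complex.Im (f z)).

Definition norm2 f : \bar R :=
  Lnorm (@gauss R) 2%:E (fun z => (Normc.normc (f z))%:E).

Definition L2 : set (plane R -> R[i]) := [set f |
  [/\ measurable_fun setT (fun z => complex.Re (f z)),
      measurable_fun setT (fun z => complex.Im (f z)) &
      (norm2 f < +oo)%E]].

Definition inner f g : R[i] := cintegral (fun z => f z * (g z)^*).

Definition span (u : nat -> plane R -> R[i]) : set (plane R -> R[i]) :=
  [set f | exists (N : nat) (c : nat -> R[i]),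
     f = fun z => \sum_(n < N) c n * u n z].

Definition L2closure (S : set (plane R -> R[i])) : set (plane R -> R[i]) :=
  [set f | L2 f /\ forall e : R, 0 < e ->
     exists2 g, S g & (norm2 (fun z => (f z - g z)%R) < e%:E)%E].

(* Sums of L^2-summable families (u_l), u_l in E_l: convergence is along the
   net of finite subsets of Z, hence unconditional. *)
Definition hilbert_sum (E : int -> set (plane R -> R[i])) :
    set (plane R -> R[i]) :=
  [set f | L2 f /\ exists2 u : int -> plane R -> R[i],
     (forall l, E l (u l)) &
     forall e : R, 0 < e -> exists F0 : {fset int}, forall F : {fset int},
       (F0 `<=` F)%fset ->
       (norm2 (fun z => (f z - \sum_(l <- F) u l z)%R) < e%:E)%E].

Definition orthogonal_family (E : int -> set (plane R -> R[i])) :=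
  forall k l, k != l -> forall f g, E k f -> E l g -> inner f g = 0.

End L2mu.

Section cauchy.
Context (R : realType).

(* For f in L^2_mu the integrand is mu-integrable for almost every z. *)
Definition cauchy (f : plane R -> R[i]) (z : plane R) : R[i] :=
  (pi^-1)%:C * cintegral (fun xi => f xi / (toC z - toC xi)).

(* C_mu is compact of infinite rank, so its range is not closed in L^2_mu,
   whereas [hilbert_sum E] is closed as soon as the E_l are closed and pairwise
   orthogonal: a Hilbertian decomposition of the range can only be one of
   [L2closure cauchy_range]. *)
Definition cauchy_range : set (plane R -> R[i]) :=
  [set g | L2 g /\ exists2 f, L2 f & {ae @gauss R, forall z, g z = cauchy f z}].

Definition rising (a : R) (k : nat) : R := \prod_(i < k) (a + i%:R).

(* 1F1(a; b; x); the series terminates when -a is a natural number. *)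
Definition kummer (a b x : R) : R :=
  limn (series (fun k => rising a k / rising b k * (x ^+ k / k`!%:R))).

Definition hermite (m n : nat) (z : plane R) : R[i] :=
  if (m <= n)%N then
    ((-1) ^+ m * n`!%:R / (n - m)`!%:R)%:C * ((toC z)^*) ^+ (n - m)
      * (kummer (- m%:R) ((n - m).+1)%:R (sqmod z))%:C
  else
    ((-1) ^+ n * m`!%:R / (m - n)`!%:R)%:C * (toC z) ^+ (m - n)
      * (kummer (- n%:R) ((m - n).+1)%:R (sqmod z))%:C.

Definition psi (m n : nat) : plane R -> R[i] := cauchy (hermite m n).

Definition Eplus (j : nat) := L2closure (span (fun n => psi n (n + j))).
Definition Eminus (j : nat) := L2closure (span (fun n => psi (n + j) n)).

Definition Espace (l : int) : set (plane R -> R[i]) :=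
  if 0 <= l then Eplus `|l|%N else Eminus `|l|%N.

End cauchy.

(* Main.v *)
From HB Require Import structures.
Require Import Defs.
From mathcomp Require Import all_boot all_order all_algebra finmap complex.
From mathcomp Require Import all_classical all_reals all_analysis.
From mathcomp Require Import measurable_realfun ring lra zify.

Set Implicit Arguments.
Unset Strict Implicit.
Unset Printing Implicit Defensive.

Import Order.TTheory GRing.Theory Num.Theory.
Import numFieldNormedType.Exports.

Local Open Scope classical_set_scope.
Local Open Scope ring_scope.
Local Open Scope complex_scope.

(** Rotating the plane by a unit [w] multiplies [hermite m n] by [w^(m - n)] and
    the kernel [1 / (z - xi)] by [w^-1], hence it multiplies [psi m n] by
    [w^(m - n - 1)].  For [w = (3 + 4 i) / 5], which is not a root of unity, the
    invariance of the Gaussian measure makes the spaces [E_l] pairwise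
    orthogonal.  The Cauchy transform is bounded by the Schur test, and the
    combinations of Ito-Hermite polynomials are all the polynomials in [z] and
    its conjugate, which are dense; so combinations of the [psi m n] are dense in
    the range.  If [g] is in the closure of the range and [u_l] is its orthogonal
    projection on [E_l], then [g - sum_(l in F) u_l] is orthogonal to [E_l] for
    [l] in [F], hence not longer than [g - v] for any [v] in the sum of these
    spaces, and [v] can be chosen close to [g].

    For the density, a function orthogonal to all polynomials is orthogonal to
    the polynomials in [sin (a (x - s))] and [sin (b (y - t))], by dominated
    convergence of the power series; indicators of quadrants are bounded limits
    of these, and generate the Borel sets. *)

(** * Orthogonal projection *)
Section projection.
Context (R : realType) (V : zmodType) (sc : R -> V -> V) (b : V -> V -> R).
Variable L : V -> Prop.
Hypothesis LD : forall u v, L u -> L v -> L (u + v).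
Hypothesis LN : forall u, L u -> L (- u).
Hypothesis LZ : forall a u, L u -> L (sc a u).
Hypothesis bC : forall u v, b u v = b v u.
Hypothesis bD : forall u v w, L u -> L v -> L w -> b (u + v) w = b u w + b v w.
Hypothesis bN : forall u w, L u -> L w -> b (- u) w = - b u w.
Hypothesis bZ : forall a u w, L u -> L w -> b (sc a u) w = a * b u w.
Hypothesis b_ge0 : forall u, 0 <= b u u.
Hypothesis b_complete : forall s : nat -> V, (forall n, L (s n)) ->
  (forall n m, (n <= m)%N ->
    b (s m - s n) (s m - s n) <= 4 / n.+1%:R) ->
  exists2 p, L p & forall e, 0 < e ->
    exists N, forall n, (N <= n)%N -> b (p - s n) (p - s n) < e.

#[local] Hint Resolve LD LN LZ : core.

Lemma form_addr u v w : L u -> L v -> L w -> b w (u + v) = b w u + b w v.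
Proof. by move=> *; rewrite bC bD// !(bC w). Qed.

Lemma form_oppr u w : L u -> L w -> b w (- u) = - b w u.
Proof. by move=> *; rewrite bC bN// (bC w). Qed.

Lemma form_scaler a u w : L u -> L w -> b w (sc a u) = a * b w u.
Proof. by move=> *; rewrite bC bZ// (bC w). Qed.

Let bDr := form_addr.
Let bNr := form_oppr.
Let bZr := form_scaler.

Lemma form_sqrD u v : L u -> L v -> b (u + v) (u + v) = b u u + 2 * b u v + b v v.
Proof. by move=> Lu Lv; rewrite bD ?bDr; auto; rewrite (bC v u); ring. Qed.

Lemma form_sqrB u v : L u -> L v -> b (u - v) (u - v) = b u u - 2 * b u v + b v v.
Proof. by move=> Lu Lv; rewrite form_sqrD ?bNr ?bN ?bNr; auto; ring. Qed.

Lemma form_CauchySchwarz u v : L u -> L v -> b u v ^+ 2 <= b u u * b v v.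
Proof.
move=> Lu Lv.
have H t : 0 <= b u u - 2 * t * b u v + t ^+ 2 * b v v.
  have := b_ge0 (u - sc t v).
  rewrite form_sqrB; auto.
  by rewrite !bZr ?bZ; auto => h; lra.
have [v0|v0] := eqVneq (b v v) 0.
  have := H ((b u u + 1) / (b u v)); rewrite v0.
  have [->|uv0] := eqVneq (b u v) 0; first by move=> _; rewrite expr0n/= mulr0.
  have -> : 2 * ((b u u + 1) / b u v) * b u v = 2 * (b u u + 1) by field.
  by have := b_ge0 u; lra.
have vp : 0 < b v v by rewrite lt_def v0 b_ge0.
have := H (b u v / b v v).
have -> : b u u - 2 * (b u v / b v v) * b u v + (b u v / b v v) ^+ 2 * b v v =
  (b u u * b v v - b u v ^+ 2) / b v v by field.
by rewrite pmulr_lge0 ?invr_gt0// subr_ge0.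
Qed.

Lemma orthogonal_limit r s : L r -> L s ->
  (forall e, 0 < e -> exists t, [/\ L t, b r t = 0 & b (s - t) (s - t) < e]) ->
  b r s = 0.
Proof.
move=> Lr Ls H; apply/eqP; apply: contraT => rs0.
have rs2 : 0 < b r s ^+ 2 by rewrite exprn_even_gt0//= orbC.
have rp : 0 < b r r + 1 by have := b_ge0 r; lra.
have [t [Lt rt st]] := H (b r s ^+ 2 / (b r r + 1)) (divr_gt0 rs2 rp).
have := @form_CauchySchwarz r (s - t) Lr (LD Ls (LN Lt)).
have -> : b r (s - t) = b r s by rewrite bDr ?bNr ?rt; auto; lra.
move: st; rewrite ltr_pdivlMr// => st le.
by have := b_ge0 (s - t); have := b_ge0 r; nra.
Qed.

Variable S : V -> Prop.
Hypothesis S0 : S 0.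
Hypothesis SL : forall u, S u -> L u.
Hypothesis SD : forall u v, S u -> S v -> S (u + v).
Hypothesis SZ : forall a u, S u -> S (sc a u).

Lemma projection_exists g : L g -> exists p, [/\ L p,
  forall e, 0 < e -> exists2 s, S s & b (p - s) (p - s) < e &
  forall s, S s -> b (g - p) s = 0].
Proof.
move=> Lg.
pose D : set R := [set b (g - s) (g - s) | s in S].
have D0 : D !=set0 by exists (b (g - 0) (g - 0)); exists 0.
have Dlb : lbound D 0 by move=> _ [s _ <-]; exact: b_ge0.
have Dinf : has_inf D by split=> //; exists 0.
pose d := inf D.
have dle s : S s -> d <= b (g - s) (g - s).
  by move=> Ss; apply: ge_inf; [exists 0 | exists s].
have /choice[s sP] : forall n : nat, exists s, S s /\ b (g - s) (g - s) < d + n.+1%:R^-1.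
  move=> n; have n0 : (0 : R) < n.+1%:R^-1 by rewrite invr_gt0.
  by have [_ [s Ss <-] ?] := inf_adherent n0 Dinf; exists s.
have Ss n : S (s n) by have [] := sP n.
have Ls n : L (s n) by apply: SL.
have expand u v : L u -> L v -> b (u - v) (u - v) = b u u - 2 * b u v + b v v by exact: form_sqrB.
have [n m nm| p Lp ps] := b_complete Ls.
  have [_ gn] := sP n; have [_ gm] := sP m.
  have := dle (sc 2^-1 (s n + s m)) (SZ _ (SD (Ss n) (Ss m))).
  have mn : (m.+1%:R : R)^-1 <= n.+1%:R^-1 by rewrite lef_pV2 ?posrE// ler_nat.
  move: gn gm; rewrite !expand//; auto.
  rewrite !bZr ?bZ ?form_sqrD ?bDr; auto.
  rewrite (bC (s m) (s n)).
  move: (n.+1%:R^-1) (m.+1%:R^-1) mn => a c ? ? ? ?; lra.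
exists p; split=> // [e e0|t St].
  by have [N HN] := ps e e0; exists (s N) => //; exact: HN.
have Lt : L t by exact: SL.
have near_orth n : b (g - s n) t ^+ 2 <= (1 + b t t) / n.+1%:R.
  have [_ gn] := sP n.
  have tp : 0 < 1 + b t t by have := b_ge0 t; lra.
  pose k := b (g - s n) t / (1 + b t t).
  have := dle (s n + sc k t) (SD (Ss n) (SZ _ St)).
  have -> : g - (s n + sc k t) = (g - s n) - sc k t by rewrite opprD addrA.
  rewrite (@form_sqrB (g - s n)); auto; rewrite !bZr ?bZ; auto => h.
  have xk : b (g - s n) t = k * (1 + b t t) by rewrite /k; field; lra.
  rewrite xk in h *; move: (n.+1%:R^-1) gn => a gn.
  have ka : k ^+ 2 * (1 + b t t) <= a by have := sqr_ge0 k; lra.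
  rewrite (_ : (k * _) ^+ 2 = (1 + b t t) * (k ^+ 2 * (1 + b t t))); last by ring.
  by rewrite ler_wpM2l// ltW.
apply/eqP; apply: contraT => x0.
have tp : 0 < 1 + b t t by have := b_ge0 t; lra.
pose e := b (g - p) t ^+ 2 / (8 * (1 + b t t)).
have e0 : 0 < e by apply: divr_gt0; [rewrite exprn_even_gt0 | rewrite mulr_gt0].
have [N HN] := ps e e0.
have [M _ HM] := near_infty_natSinv_lt (PosNum e0).
pose n := maxn N M.
have := HN n (leq_maxl _ _); have := HM n (leq_maxr _ _) => /= nM pn.
have := near_orth n; have := @form_CauchySchwarz (p - s n) t ltac:(auto) Lt.
have : b (g - p) t = b (g - s n) t - b (p - s n) t.
  by rewrite -bN -?bD; auto; congr (b _ _); rewrite opprB addrA subrK.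
have : b (g - p) t ^+ 2 = e * (8 * (1 + b t t)) by rewrite /e; field; lra.
move: (b (g - p) t) (b (g - s n) t) (b (p - s n) t) => x y z xe xyz zle yle.
have := b_ge0 (p - s n); have := b_ge0 t; have := sqr_ge0 (y + z).
move: (b (p - s n) _) (b t t) (n.+1%:R^-1) pn nM zle yle xe tp => r T a.
rewrite {}xyz => ra ae zle yle xe tp yz r0 T0.
have : z ^+ 2 <= e * T by apply: le_trans zle _; rewrite ler_wpM2r// ltW.
have : y ^+ 2 <= (1 + T) * e.
  by apply: le_trans yle _; rewrite ler_wpM2l// ltW.
nra.
Qed.
End projection.

(** * Completeness of the space of square-integrable functions *)
Section square_complete.
Context d (T : measurableType d) (R : realType).
Variable mu : {measure set T -> \bar R}.

Lemma limn_esup_le (u : (\bar R)^nat) (c : \bar R) :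
  (forall n, (u n <= c)%E) -> (limn_esup u <= c)%E.
Proof.
move=> uc; apply: (@le_trans _ _ (ereal_sup (u @` setT))).
  by apply: ereal_inf_lbound; exists setT => //; exact: filterT.
by apply: ge_ereal_sup => _ [n _ <-].
Qed.

Lemma limn_einf_sup_EFin (u : R^nat) (l : R) : u @ \oo --> l ->
  limn_einf (fun n => (u n)%:E) = l%:E /\ limn_esup (fun n => (u n)%:E) = l%:E.
Proof.
move=> ul; have : (u n)%:E @[n --> \oo] --> l%:E by apply: cvg_EFin => //; exact: nearW.
by move=> /cvg_limn_einf_sup[].
Qed.

Lemma norm_le_AMGM (a p : R) : 0 < p -> `|a| <= p^-1 + p * a ^+ 2.
Proof.
move=> p0; have h : 0 <= p^-1 * (`|a| * p - 1) ^+ 2.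
  by rewrite mulr_ge0 ?sqr_ge0// invr_ge0 ltW.
have : p^-1 * (`|a| * p - 1) ^+ 2 = p * `|a| ^+ 2 - 2 * `|a| + p^-1.
  by field; rewrite gt_eqF.
rewrite real_normK ?num_real//; have := normr_ge0 a; lra.
Qed.

Lemma ae_cvg_of_geometric_increments (g : nat -> T -> R) :
  (forall n, measurable_fun setT (g n)) ->
  (forall n, \int[mu]_x (((g n.+1 x - g n x) ^+ 2)%:E) <= (4^-1 ^+ n)%:E)%E ->
  {ae mu, forall x, cvgn (g ^~ x)}.
Proof.
move=> mg gle.
pose G n x := ((2 ^+ n * (g n.+1 x - g n x) ^+ 2)%:E : \bar R).
have mG n : measurable_fun setT (G n).
  apply/measurable_EFinP/measurable_funM => //.
  by apply: measurable_funX; apply: measurable_funB.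
have G0 n x : (0 <= G n x)%E by rewrite lee_fin mulr_ge0 ?sqr_ge0 ?exprn_ge0.
pose S x := (\sum_(0 <= n <oo) G n x)%E.
have mS : measurable_fun setT S by apply: ge0_emeasurable_sum => // *; exact: G0.
have iS : (\int[mu]_x S x < +oo)%E.
  rewrite integral_nneseries//.
  apply: (@le_lt_trans _ _ (\sum_(0 <= n <oo) (1 / (2 ^ (n + 0))%:R)%:E)%E).
    apply: lee_nneseries => [n _ _|n _]; first exact: integral_ge0.
    rewrite /G; under eq_integral do rewrite EFinM.
    rewrite ge0_integralZl//; last first.
    - by move=> x _; rewrite lee_fin sqr_ge0.
    - by apply/measurable_EFinP; apply: measurable_funX; apply: measurable_funB.
    apply: (le_trans (lee_pmul _ _ (lexx _) (gle n))).
    - by rewrite lee_fin exprn_ge0.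
    - by apply: integral_ge0 => x _; rewrite lee_fin sqr_ge0.
    rewrite -EFinM lee_fin addn0 natrX div1r -exprMn -exprVn.
    by rewrite (_ : 2 * 4^-1 = 2^-1 :> R)//; field.
  have := @cvg_geometric_eseries_half R 2 0.
  rewrite expr0 divr1 => h; rewrite (_ : \sum_(_ <= _ <oo) _ = 2%:E)%E ?ltry//.
  apply/cvg_lim => //; apply: cvg_trans h; apply: near_eq_cvg; apply: nearW => n.
  apply: eq_bigr => k _; congr (_%:E).
  by rewrite addn1 addn0 expnS natrM invfM mulrA divff.
have : {ae mu, forall x, setT x -> S x \is a fin_num}.
  apply: integrable_ae => //; apply/integrableP; split=> //.
  rewrite (eq_integral S)// => x _; rewrite gee0_abs//.
  by apply: nneseries_ge0 => n _ _; exact: G0.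
apply: filterS => x /(_ I) Sx.
have cd : cvgn (series (telescope (g ^~ x))).
  apply: normed_cvg => /=.
  pose v n := 2^-1 ^+ n + 2 ^+ n * (g n.+1 x - g n x) ^+ 2.
  apply: (@series_le_cvg _ _ v) => [n|n|n|].
  - exact: normr_ge0.
  - by apply: addr_ge0; [rewrite exprn_ge0|rewrite mulr_ge0 ?sqr_ge0 ?exprn_ge0].
  - by rewrite /v /telescope exprVn norm_le_AMGM// exprn_gt0.
  - rewrite (_ : series v = series (geometric 1 2^-1) +
        series (fun n => 2 ^+ n * (g n.+1 x - g n x) ^+ 2)); last first.
      by apply/funext => n; rewrite /series/= fctE -big_split/=;
        apply: eq_bigr => i _; rewrite mul1r.
    apply: is_cvgD; first by apply: is_cvg_geometric_series;
      rewrite gtr0_norm ?invr_gt0// invf_lt1// ltr1n.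
    apply: nnseries_is_cvg => [n|]; first by rewrite mulr_ge0 ?sqr_ge0 ?exprn_ge0.
    by move: Sx; rewrite ge0_fin_numE//; apply: nneseries_ge0 => n _ _; exact: G0.
rewrite (_ : g ^~ x = cst (g 0 x) + series (telescope (g ^~ x))).
  by apply: is_cvgD => //; exact: is_cvg_cst.
by apply/funext => n; rewrite fctE -eq_sum_telescope.
Qed.

Lemma square_integrable_complete (s : nat -> T -> R) :
  (forall n, measurable_fun setT (s n)) ->
  (forall n m, (n <= m)%N ->
    \int[mu]_x ((s m x - s n x) ^+ 2)%:E <= (4 / n.+1%:R)%:E)%E ->
  exists2 f : T -> R, measurable_fun setT f &
    forall n, (\int[mu]_x ((f x - s n x) ^+ 2)%:E <= (4 / n.+1%:R)%:E)%E.
Proof.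
move=> ms sle.
pose k n := (4 * 4 ^ n)%N.
have kn n : (n <= k n)%N by rewrite (leq_trans (ltnW (ltn_expl n (isT : 1 < 4)%N)))// leq_pmull.
have kS n : (k n <= k n.+1)%N by rewrite leq_mul2l/= leq_exp2l.
have ae_cvg := ae_cvg_of_geometric_increments (g := fun n => s (k n)) (fun n => ms _).
have {}ae_cvg : {ae mu, forall x, cvgn (fun n => s (k n) x)}.
  apply: ae_cvg => n; apply: (le_trans (sle _ _ (kS n))); rewrite lee_fin.
  rewrite ler_pdivrMr// exprVn ler_pdivlMl ?exprn_gt0//.
  by rewrite mulrC -natrX -natrM ler_nat leqW.
pose f x := fine (limn_esup (fun n => (s (k n) x)%:E)).
have mf : measurable_fun setT f.
  apply: measurableT_comp => //; apply: measurable_fun_limn_esup => n.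
  exact/measurable_EFinP.
have fE x : cvgn (fun n => s (k n) x) -> s (k n) x @[n --> \oo] --> f x.
  by move=> /cvg_ex[l cl]; rewrite /f (limn_einf_sup_EFin cl).2.
exists f => // n.
pose u m x := (((s (k (m + n)%N) x - s n x) ^+ 2)%:E : \bar R).
have mu_ m : measurable_fun setT (u m).
  by apply/measurable_EFinP; apply: measurable_funX; apply: measurable_funB.
have u0 m x : (0 <= u m x)%E by rewrite lee_fin sqr_ge0.
rewrite (ge0_ae_eq_integral (g := fun x => limn_einf (u ^~ x)))//.
- apply: (le_trans (fatou _ _ _ _)) => //.
  apply: (le_trans (limn_einf_sup _)); apply: limn_esup_le => m.
  by apply: sle; rewrite (leq_trans (leq_addl m n)).
- by apply/measurable_EFinP; apply: measurable_funX; apply: measurable_funB.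
- apply: (measurableT_comp (f := -%E)) => //.
  by apply: measurable_fun_limn_esup => m; apply: (measurableT_comp (f := -%E)).
- by move=> x _; rewrite lee_fin sqr_ge0.
- move=> x _; rewrite /limn_einf leeNr oppe0; apply: limn_esup_le => m.
  by rewrite leeNl oppe0.
- move: ae_cvg; apply: filterS => x cx _.
  have fx := fE x cx; rewrite -(cvg_shiftn n) in fx.
  have h : s (k (m + n)%N) x - s n x @[m --> \oo] --> f x - s n x.
    by apply: cvgB => //; exact: cvg_cst.
  by have [] := limn_einf_sup_EFin (cvgM h h).
Qed.

End square_complete.

(** * The Gaussian measure *)
Section density.
Context d (T : measurableType d) (R : realType).
Variables (mu nu : {measure set T -> \bar R}) (g : T -> R).
Hypothesis mg : measurable_fun setT g.
Hypothesis g0 : forall x, 0 <= g x.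
Hypothesis nuE : forall A, measurable A -> nu A = (\int[mu]_(x in A) (g x)%:E)%E.

Import HBNNSimple.

Lemma ge0_integral_density (f : T -> \bar R) : measurable_fun setT f ->
  (forall x, 0 <= f x)%E ->
  (\int[nu]_x f x = \int[mu]_x (f x * (g x)%:E))%E.
Proof.
move=> mf f0; pose f_ := nnsfun_approx measurableT mf.
have mgE : measurable_fun setT (fun x => (g x)%:E) by exact/measurable_EFinP.
transitivity (limn (fun n => \int[nu]_x (f_ n x)%:E)%E).
  rewrite -monotone_convergence//.
  - apply: eq_integral => y _; apply/esym/cvg_lim => //.
    by apply: cvg_nnsfun_approx => // *; apply: f0.
  - by move=> n; exact/measurable_EFinP/measurable_funP.
  - by move=> n y _; rewrite lee_fin.
  - by move=> y _ m n mn; rewrite lee_fin; exact/lefP/nd_nnsfun_approx.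
transitivity (limn (fun n => \int[mu]_x ((f_ n x)%:E * (g x)%:E))%E); last first.
  rewrite -monotone_convergence//.
  - apply: eq_integral => y _; apply/cvg_lim => //.
    apply: cvgeZr => //; apply: cvg_nnsfun_approx => // *; exact: f0.
  - by move=> n; apply: emeasurable_funM => //; exact/measurable_EFinP/measurable_funP.
  - by move=> n y _; rewrite mule_ge0// lee_fin.
  - move=> y _ m n mn; rewrite lee_wpmul2r// ?lee_fin//.
    exact/lefP/nd_nnsfun_approx.
congr (limn _); apply/funext => n.
have mI r : measurable (f_ n @^-1` [set r]) by exact: measurable_sfunP.
under eq_integral do rewrite fimfunE -fsumEFin//.
rewrite ge0_integral_fsum//; last 2 first.
- by move=> y; exact/measurable_EFinP/measurable_funM.
- by move=> y x _; rewrite nnfun_muleindic_ge0.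
under [RHS]eq_integral => x _.
  rewrite fimfunE -fsumEFin// ge0_mule_fsuml; last first.
    by move=> r; rewrite nnfun_muleindic_ge0.
  over.
rewrite ge0_integral_fsum//; last 2 first.
- move=> y; apply: emeasurable_funM => //; exact/measurable_EFinP/measurable_funM.
- by move=> y x _; rewrite mule_ge0 ?nnfun_muleindic_ge0 ?lee_fin.
apply: eq_fsbigr => r _; rewrite integralZl_indic_nnsfun// integral_indic//= setIT.
rewrite nuE//; have [r0|r0] := ltP r 0.
  rewrite preimage_nnfun0// integral_set0 mule0; apply/esym.
  by apply: integral0_eq => x _; rewrite indicE in_set0 mulr0 mul0e.
rewrite integral_mkcond -ge0_integralZl//.
- apply: eq_integral => x _; rewrite EFinM -muleA; congr (_ * _)%E.
  by rewrite patchE indicE; case: ifPn => _; rewrite ?mul1e ?mul0e.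
- by apply/(measurable_restrictT _ _).1 => //; exact: measurable_funTS.
- by move=> x _; rewrite patchE; case: ifPn => _ //; rewrite lee_fin.
Qed.

End density.

Section lebesgue_translation.
Context (R : realType).
Local Notation mu := (@lebesgue_measure R).

Lemma lebesgue_measure_translation (c : R) (A : set R) : measurable A ->
  pushforward mu ((fun x => x + c) : _ -> measurableTypeR R) A = mu A.
Proof.
move=> mA; apply/esym/lebesgue_measure_unique => //=.
  apply: measurable_funD; [exact: measurable_id|exact: measurable_cst].
move=> mc _ [[a b]] _ <-; rewrite /pushforward.
rewrite (_ : _ @^-1` _ = `]a - c, b - c]%classic); last first.
  by apply/seteqP; split=> x /=; rewrite !in_itv/= ltrBlDr lerBrDr.
rewrite !lebesgue_measure_itv/= !lte_fin ltrD2r; case: ifPn => // _.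
by rewrite -!EFinB; congr (_%:E); ring.
Qed.

Lemma ge0_integral_translation (c : R) (f : R -> \bar R) : measurable_fun setT f ->
  (forall x, 0 <= f x)%E -> (\int[mu]_x f (x + c)%R = \int[mu]_x f x)%E.
Proof.
move=> mf f0.
have mc : measurable_fun setT ((fun x => x + c) : measurableTypeR R -> measurableTypeR R).
  apply: measurable_funD; [exact: measurable_id|exact: measurable_cst].
transitivity (\int[pushforward mu ((fun x => x + c)%R : _ -> measurableTypeR R)]_x f x)%E.
  by rewrite ge0_integral_pushforward.
by apply: eq_measure_integral => A mA _; exact: lebesgue_measure_translation.
Qed.

Lemma ge0_integral_reflection (f : R -> \bar R) : measurable_fun setT f ->
  (forall x, 0 <= f x)%E -> (\int[mu]_x f (- x)%R = \int[mu]_x f x)%E.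
Proof.
move=> mf f0; have mc : measurable_fun setT (-%R : measurableTypeR R -> measurableTypeR R) by [].
transitivity (\int[pushforward mu (-%R : _ -> measurableTypeR R)]_x f x)%E.
  by rewrite ge0_integral_pushforward.
by apply: eq_measure_integral => A mA _; exact: lebesgue_measureN.
Qed.

End lebesgue_translation.

Section plane_gauss.
Context (R : realType).
Implicit Types (f : plane R -> \bar R) (z : plane R).
Local Notation mu := (@lebesgue_measure R).

Lemma ge0_integral_area_prod (a b : R -> \bar R) :
  measurable_fun setT a -> measurable_fun setT b ->
  (forall x, 0 <= a x)%E -> (forall x, 0 <= b x)%E ->
  (\int[area R]_z (a z.1 * b z.2) = (\int[mu]_x a x) * (\int[mu]_x b x))%E.
Proof.
move=> ma mb a0 b0; rewrite /area fubini_tonelli1//; last 2 first.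
- by apply: emeasurable_funM; apply: measurableT_comp.
- by move=> z; exact: mule_ge0.
rewrite /fubini_F/=; under eq_integral do rewrite ge0_integralZl//.
by rewrite ge0_integralZr// integral_ge0.
Qed.

(* A rotation is a product of three shears, and a shear preserves the area by
   Fubini and translation invariance. *)
Definition shear1 (t : R) (z : plane R) : plane R := (z.1 + t * z.2, z.2).
Definition shear2 (t : R) (z : plane R) : plane R := (z.1, z.2 + t * z.1).

Lemma measurable_shear1 t : measurable_fun setT (shear1 t).
Proof.
apply/measurable_fun_pair => //=; apply: measurable_funD => //.
by apply: measurable_funM.
Qed.

Lemma measurable_shear2 t : measurable_fun setT (shear2 t).
Proof.
apply/measurable_fun_pair => //=; apply: measurable_funD => //.
by apply: measurable_funM.
Qed.

Lemma ge0_integral_shear1 t f : measurable_fun setT f -> (forall z, 0 <= f z)%E ->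
  (\int[area R]_z f (shear1 t z) = \int[area R]_z f z)%E.
Proof.
move=> mf f0; rewrite /area !fubini_tonelli2//; last first.
  by apply: measurableT_comp => //; exact: measurable_shear1.
apply: eq_integral => y _; rewrite /fubini_G/shear1/=.
rewrite (ge0_integral_translation (t * y) (f := fun x => f (x, y)))//.
exact: measurableT_comp.
Qed.

Lemma ge0_integral_shear2 t f : measurable_fun setT f -> (forall z, 0 <= f z)%E ->
  (\int[area R]_z f (shear2 t z) = \int[area R]_z f z)%E.
Proof.
move=> mf f0; rewrite /area !fubini_tonelli1//; last first.
  by apply: measurableT_comp => //; exact: measurable_shear2.
apply: eq_integral => x _; rewrite /fubini_F/shear2/=.
rewrite (ge0_integral_translation (t * x) (f := fun y => f (x, y)))//.
exact: measurableT_comp.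
Qed.

Lemma ge0_integral_gauss f : measurable_fun setT f -> (forall z, 0 <= f z)%E ->
  (\int[@gauss R]_z f z = \int[area R]_z (f z * (expR (- sqmod z))%:E))%E.
Proof.
apply: ge0_integral_density => //.
by apply: measurableT_comp => //; apply: measurableT_comp => //; exact: measurable_sqmod.
Qed.

(* Multiplication by the unit (3 + 4i)/5, which is not a root of unity. *)
Definition turn (z : plane R) : plane R :=
  (3 / 5 * z.1 - 4 / 5 * z.2, 4 / 5 * z.1 + 3 / 5 * z.2).

Lemma turnE : turn = shear1 (- 2^-1) \o shear2 (4 / 5) \o shear1 (- 2^-1).
Proof.
apply/funext => z; rewrite /turn /shear1 /shear2/=.
by congr (_, _); field.
Qed.

Lemma measurable_turn : measurable_fun setT turn.
Proof.
rewrite turnE; apply: measurableT_comp; last exact: measurable_shear1.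
apply: measurableT_comp; [exact: measurable_shear1|exact: measurable_shear2].
Qed.

Lemma sqmod_turn z : sqmod (turn z) = sqmod z.
Proof. by rewrite /sqmod/=; field. Qed.

Lemma ge0_integral_gauss_turn f : measurable_fun setT f -> (forall z, 0 <= f z)%E ->
  (\int[@gauss R]_z f (turn z) = \int[@gauss R]_z f z)%E.
Proof.
move=> mf f0; pose g z := (f z * (expR (- sqmod z))%:E)%E.
have g0 z : (0 <= g z)%E by rewrite mule_ge0// lee_fin expR_ge0.
have mg : measurable_fun setT g.
  apply: emeasurable_funM => //; apply/measurable_EFinP.
  by apply: measurableT_comp => //; apply: measurableT_comp => //; exact: measurable_sqmod.
rewrite !ge0_integral_gauss//; last exact: measurableT_comp measurable_turn.
have m1 := measurable_shear1 (- 2^-1); have m2 := measurable_shear2 (4 / 5).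
have mg1 : measurable_fun setT (g \o shear1 (- 2^-1)) by exact: measurableT_comp.
have mg2 : measurable_fun setT (g \o shear1 (- 2^-1) \o shear2 (4 / 5)).
  exact: measurableT_comp.
rewrite -/(g _) -[RHS](ge0_integral_shear1 (- 2^-1))//.
rewrite -[RHS](ge0_integral_shear2 (4 / 5) mg1 (fun z => g0 _)).
rewrite -[RHS](ge0_integral_shear1 (- 2^-1) mg2 (fun z => g0 _)).
apply: eq_integral => z _; rewrite /= /g.
have -> : shear1 (- 2^-1) (shear2 (4 / 5) (shear1 (- 2^-1) z)) = turn z by rewrite turnE.
by rewrite sqmod_turn.
Qed.

Lemma integral_expR_normr_lty (c : R) :
  (\int[mu]_x (expR (c * `|x|) * expR (- x ^+ 2))%:E < +oo)%E.
Proof.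
pose g (x : R) := (expR (c ^+ 2 / 4) * gauss_fun (x - c / 2))%:E.
have mgf : measurable_fun setT (fun x : R => (gauss_fun x)%:E).
  by apply/measurable_EFinP; exact: measurable_gauss_fun.
have mg : measurable_fun setT g.
  apply/measurable_EFinP; apply: measurable_funM => //.
  apply: measurableT_comp; first exact: measurable_gauss_fun.
  exact: measurable_funB.
have g0 x : (0 <= g x)%E by rewrite lee_fin mulr_ge0 ?expR_ge0// gauss_fun_ge0.
have gfin : (\int[mu]_x g x < +oo)%E.
  rewrite /g; under eq_integral do rewrite EFinM.
  rewrite ge0_integralZl//; last first.
  - by move=> x _; rewrite lee_fin gauss_fun_ge0.
  - apply: (measurableT_comp (f := EFin \o @gauss_fun R)) => //.
    exact: measurable_funB.
  rewrite (ge0_integral_translation (- (c / 2)) (f := EFin \o @gauss_fun R))//; last first.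
    by move=> x; rewrite lee_fin gauss_fun_ge0.
  by rewrite integralT_gauss -EFinM ltry.
apply: (@le_lt_trans _ _ (\int[mu]_x (g x + g (- x)%R))%E).
  apply: ge0_le_integral => //.
  - apply/measurable_EFinP; apply: measurable_funM; apply: measurableT_comp => //.
      by apply: measurable_funM => //; exact: measurable_normr.
    by apply: measurable_funN; exact: measurable_funX.
  - by apply: emeasurable_funD => //; exact: measurableT_comp.
  move=> x _; rewrite -EFinD lee_fin -!expRD /gauss_fun.
  have [x0|x0] := leP 0 x; [rewrite ger0_norm//|rewrite ltr0_norm//].
    rewrite (_ : c * x - x ^+ 2 = c ^+ 2 / 4 - (x - c / 2) ^+ 2); last by field.
    by rewrite expRD ler_wpDr// mulr_ge0 ?expR_ge0.
  rewrite (_ : c * - x - x ^+ 2 = c ^+ 2 / 4 - (- x - c / 2) ^+ 2); last by field.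
  by rewrite expRD ler_wpDl// mulr_ge0 ?expR_ge0.
rewrite ge0_integralD//; last exact: measurableT_comp.
by rewrite ge0_integral_reflection// lte_add_pinfty.
Qed.

Lemma integral_gauss_expR_lty (c : R) :
  (\int[@gauss R]_z (expR (c * `|z.1|) * expR (c * `|z.2|))%:E < +oo)%E.
Proof.
pose h (x : R) := (expR (c * `|x|) * expR (- x ^+ 2))%:E.
have mn : measurable_fun setT (fun x : R => expR (c * `|x|)).
  by apply: measurableT_comp => //; apply: measurable_funM => //; exact: measurable_normr.
have mh : measurable_fun setT h.
  apply/measurable_EFinP; apply: measurable_funM => //; apply: measurableT_comp => //.
  by apply: measurable_funN; exact: measurable_funX.
have h0 x : (0 <= h x)%E by rewrite lee_fin mulr_ge0 ?expR_ge0.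
rewrite ge0_integral_gauss//; last first.
  by apply/measurable_EFinP; apply: measurable_funM;
    apply: (measurableT_comp (f := fun x : R => expR (c * `|x|))).
rewrite (eq_integral (fun z => h z.1 * h z.2)%E); last first.
  by move=> z _; rewrite /h -!EFinM /sqmod opprD expRD; congr (_%:E); ring.
rewrite ge0_integral_area_prod// lte_mul_pinfty ?integral_ge0//.
- by rewrite ge0_fin_numE ?integral_ge0// integral_expR_normr_lty.
- exact: integral_expR_normr_lty.
Qed.

Lemma gauss_setT_lty : (@gauss R setT < +oo)%E.
Proof.
have := integral_gauss_expR_lty 0.
rewrite (eq_integral (cst 1%E)) ?integral_cst// ?mul1e// => z _.
by rewrite !mul0r expR0 mulr1.
Qed.

Lemma gauss_fin_num_fun : fin_num_fun (@gauss R).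
Proof.
move=> A mA; rewrite ge0_fin_numE//; apply: le_lt_trans gauss_setT_lty.
by rewrite le_measure ?inE.
Qed.

HB.instance Definition _ := @Measure_isFinite.Build _ _ _ (@gauss R) gauss_fin_num_fun.

End plane_gauss.

(** * The real inner product on square-integrable functions *)
Section L2_structure.
Context (R : realType).
Implicit Types (f g h : plane R -> R[i]) (z : plane R).
Local Notation Re := complex.Re.
Local Notation Im := complex.Im.
Local Notation mu := (@gauss R).

Definition cmeas f := measurable_fun setT (fun z => Re (f z)) /\
  measurable_fun setT (fun z => Im (f z)).

Definition sqn (c : R[i]) : R := Re c ^+ 2 + Im c ^+ 2.

Definition redot (c c' : R[i]) : R := Re c * Re c' + Im c * Im c'.

Definition rip f g : R := \int[mu]_z redot (f z) (g z).

Lemma sqn_ge0 c : 0 <= sqn c.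
Proof. by rewrite addr_ge0 ?sqr_ge0. Qed.

Lemma redot_sqn c : redot c c = sqn c.
Proof. by rewrite /redot /sqn !expr2. Qed.

Lemma normc_sqn c : Normc.normc c = Num.sqrt (sqn c).
Proof. by case: c. Qed.

Lemma Re_addc (c c' : R[i]) : Re (c + c') = Re c + Re c'.
Proof. by case: c => a b; case: c'. Qed.

Lemma Im_addc (c c' : R[i]) : Im (c + c') = Im c + Im c'.
Proof. by case: c => a b; case: c'. Qed.

Lemma Re_oppc (c : R[i]) : Re (- c) = - Re c.
Proof. by case: c. Qed.

Lemma Im_oppc (c : R[i]) : Im (- c) = - Im c.
Proof. by case: c. Qed.

Lemma Re_mulc (c c' : R[i]) : Re (c * c') = Re c * Re c' - Im c * Im c'.
Proof. by case: c => a b; case: c'. Qed.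

Lemma Im_mulc (c c' : R[i]) : Im (c * c') = Re c * Im c' + Im c * Re c'.
Proof. by case: c => a b; case: c'. Qed.

Lemma sqnM c c' : sqn (c * c') = sqn c * sqn c'.
Proof. by rewrite /sqn Re_mulc Im_mulc; ring. Qed.

Lemma cmeasD f g : cmeas f -> cmeas g -> cmeas (f + g).
Proof.
move=> [mf1 mf2] [mg1 mg2]; split.
  by rewrite (_ : (fun z => _) = fun z => Re (f z) + Re (g z));
    [exact: measurable_funD|apply/funext => z; exact: Re_addc].
by rewrite (_ : (fun z => _) = fun z => Im (f z) + Im (g z));
  [exact: measurable_funD|apply/funext => z; exact: Im_addc].
Qed.

Lemma cmeasM f g : cmeas f -> cmeas g -> cmeas (fun z => f z * g z).
Proof.
move=> [mf1 mf2] [mg1 mg2]; split.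
  rewrite (_ : (fun z => _) = fun z => Re (f z) * Re (g z) - Im (f z) * Im (g z)).
    by apply: measurable_funB; exact: measurable_funM.
  by apply/funext => z; exact: Re_mulc.
rewrite (_ : (fun z => _) = fun z => Re (f z) * Im (g z) + Im (f z) * Re (g z)).
  by apply: measurable_funD; exact: measurable_funM.
by apply/funext => z; exact: Im_mulc.
Qed.

Lemma cmeas_cst c : cmeas (fun=> c).
Proof. by split; exact: measurable_cst. Qed.

Lemma measurable_redot f g : cmeas f -> cmeas g ->
  measurable_fun setT (fun z => redot (f z) (g z)).
Proof.
by move=> [? ?] [? ?]; apply: measurable_funD; exact: measurable_funM.
Qed.

Lemma measurable_sqn f : cmeas f -> measurable_fun setT (fun z => sqn (f z)).
Proof.
by move=> [? ?]; apply: measurable_funD; exact: measurable_funX.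
Qed.

Lemma norm2E f : norm2 f = ((\int[mu]_z (sqn (f z))%:E) `^ (2^-1))%E.
Proof.
rewrite /norm2 unlock; congr (_ `^ _)%E; apply: eq_integral => z _.
rewrite normc_sqn gee0_abs ?lee_fin ?sqrtr_ge0// poweR_EFin.
by rewrite powR_mulrn ?sqrtr_ge0// sqr_sqrtr// sqn_ge0.
Qed.

Lemma L2P f : L2 f <-> cmeas f /\ (\int[mu]_z (sqn (f z))%:E < +oo)%E.
Proof.
split=> [[mr mi]|[[mr mi] h]]; last by split=> //; rewrite norm2E; exact: poweR_lty.
by rewrite norm2E => h; split=> //; apply: lty_poweRy h; rewrite invr_eq0.
Qed.

Lemma L2_cmeas f : L2 f -> cmeas f. Proof. by case/L2P. Qed.

Lemma sqn_integrable f : L2 f -> mu.-integrable setT (fun z => (sqn (f z))%:E).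
Proof.
move=> /L2P[mf foo]; apply/integrableP; split.
  by apply/measurable_EFinP; exact: measurable_sqn.
by under eq_integral do rewrite gee0_abs ?lee_fin ?sqn_ge0//.
Qed.

Lemma L2_dominated f (G : plane R -> R) : cmeas f ->
  mu.-integrable setT (EFin \o G) -> (forall z, sqn (f z) <= G z) -> L2 f.
Proof.
move=> mf iG fG; apply/L2P; split=> //.
have : mu.-integrable setT (fun z => (sqn (f z))%:E).
  apply: le_integrable iG => //; first by apply/measurable_EFinP; exact: measurable_sqn.
  move=> z _ /=; rewrite lee_fin ger0_norm ?sqn_ge0//.
  exact: le_trans (fG z) (ler_norm _).
move=> /integrableP[_]; under eq_integral do rewrite gee0_abs ?lee_fin ?sqn_ge0//.
by [].
Qed.

Lemma redot_le c c' : `|redot c c'| <= sqn c + sqn c'.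
Proof.
by rewrite ler_norml; apply/andP; split; rewrite /redot /sqn;
  have := sqr_ge0 (Re c + Re c'); have := sqr_ge0 (Im c + Im c');
  have := sqr_ge0 (Re c - Re c'); have := sqr_ge0 (Im c - Im c'); nra.
Qed.

Lemma redot_integrable f g : L2 f -> L2 g ->
  mu.-integrable setT (fun z => (redot (f z) (g z))%:E).
Proof.
move=> Lf Lg; have := integrableD measurableT (sqn_integrable Lf) (sqn_integrable Lg).
apply: le_integrable => //.
  by apply/measurable_EFinP; apply: measurable_redot; exact: L2_cmeas.
move=> z _ /=; rewrite lee_fin; apply: le_trans (redot_le _ _) _.
exact: ler_norm.
Qed.

Lemma L2D f g : L2 f -> L2 g -> L2 (f + g).
Proof.
move=> Lf Lg; apply: (@L2_dominated _ (fun z => 2 * (sqn (f z) + sqn (g z)))).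
- by apply: cmeasD; exact: L2_cmeas.
- have := integrableZl measurableT 2
    (integrableD measurableT (sqn_integrable Lf) (sqn_integrable Lg)).
  by apply: eq_integrable => // z _; rewrite /= -EFinD -EFinM.
- move=> z; rewrite /sqn Re_addc Im_addc.
  have := sqr_ge0 (Re (f z) - Re (g z)); have := sqr_ge0 (Im (f z) - Im (g z)); nra.
Qed.

Lemma L2Z c f : L2 f -> L2 (fun z => c * f z).
Proof.
move=> Lf; apply: (@L2_dominated _ (fun z => sqn c * sqn (f z))).
- by apply: cmeasM; [exact: cmeas_cst|exact: L2_cmeas].
- have := integrableZl measurableT (sqn c) (sqn_integrable Lf).
  by apply: eq_integrable => // z _; rewrite /= -EFinM.
- by move=> z; rewrite sqnM.
Qed.

Lemma L2N f : L2 f -> L2 (- f).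
Proof.
move=> /(L2Z (-1)); rewrite (_ : (fun z => _) = - f)//.
by apply/funext => z; rewrite mulN1r.
Qed.

Lemma L2B f g : L2 f -> L2 g -> L2 (f - g).
Proof. by move=> Lf Lg; apply: L2D => //; exact: L2N. Qed.

Lemma L20 : L2 (0 : plane R -> R[i]).
Proof.
apply/L2P; split; first exact: (cmeas_cst 0).
by rewrite (eq_integral (cst 0%E)) ?integral0// => z _; rewrite /sqn/= expr0n/= addr0.
Qed.

Lemma ripC f g : rip f g = rip g f.
Proof. by apply: eq_Rintegral => z _; rewrite /redot; ring. Qed.

Lemma ripD f g h : L2 f -> L2 g -> L2 h -> rip (f + g) h = rip f h + rip g h.
Proof.
move=> Lf Lg Lh; rewrite /rip -RintegralD//; try exact: redot_integrable.
by apply: eq_Rintegral => z _; rewrite /redot Re_addc Im_addc; ring.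
Qed.

Definition rscale (a : R) f := fun z => a%:C * f z.

Lemma ripZ a f h : L2 f -> L2 h -> rip (rscale a f) h = a * rip f h.
Proof.
move=> Lf Lh; rewrite /rip -RintegralZl//; last exact: redot_integrable.
by apply: eq_Rintegral => z _; rewrite /redot Re_mulc Im_mulc/=; ring.
Qed.

Lemma ripN f h : L2 f -> L2 h -> rip (- f) h = - rip f h.
Proof.
move=> Lf Lh; rewrite -[RHS]mulN1r -ripZ//; congr (rip _ _); apply/funext => z.
by rewrite /rscale rmorphN1 mulN1r.
Qed.

Lemma rip_ge0 f : 0 <= rip f f.
Proof. by apply: Rintegral_ge0 => z _; rewrite redot_sqn sqn_ge0. Qed.

Lemma rip_sqn f : L2 f -> ((rip f f)%:E = \int[mu]_z (sqn (f z))%:E)%E.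
Proof.
move=> Lf; rewrite /rip /Rintegral fineK.
  by apply: eq_integral => z _; rewrite redot_sqn.
by apply: integrable_fin_num => //; exact: redot_integrable.
Qed.

Lemma norm2_lt f (e : R) : 0 < e -> L2 f -> (norm2 f < e%:E)%E = (rip f f < e ^+ 2).
Proof.
move=> e0 Lf; rewrite norm2E -rip_sqn// poweR_EFin lte_fin powR12_sqrt ?rip_ge0//.
by rewrite -{1}(gtr0_norm e0) -sqrtr_sqr ltr_sqrt// exprn_gt0.
Qed.

Lemma ae_eq0_rip f : L2 f -> {ae mu, forall z, f z = 0} -> rip f f = 0.
Proof.
move=> Lf f0; apply: EFin_inj; rewrite rip_sqn//.
transitivity (\int[mu]_z (cst 0 z))%E; last exact: integral0.
apply: ge0_ae_eq_integral => //.
- by apply/measurable_EFinP; apply: measurable_sqn; exact: L2_cmeas.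
- by move=> z _; rewrite lee_fin sqn_ge0.
- by move: f0; apply: filterS => z -> _; rewrite /sqn/= expr0n/= addr0.
Qed.

Lemma inner_rip f g : inner f g = rip f g +i* rip f (fun z => 'i * g z).
Proof.
congr (_ +i* _); apply: eq_Rintegral => z _.
  by rewrite /redot; case: (f z) => a b; case: (g z) => c d /=; ring.
by rewrite /redot; case: (f z) => a b; case: (g z) => c d /=; ring.
Qed.

Lemma L2_complete (s : nat -> plane R -> R[i]) : (forall n, L2 (s n)) ->
  (forall n m, (n <= m)%N -> rip (s m - s n) (s m - s n) <= 4 / n.+1%:R) ->
  exists2 p, L2 p & forall e, 0 < e ->
    exists N, forall n, (N <= n)%N -> rip (p - s n) (p - s n) < e.
Proof.
move=> Ls sle.
have part (pr : R[i] -> R) : (forall c, pr c ^+ 2 <= sqn c) ->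
    (forall c c', pr (c - c') = pr c - pr c') ->
    (forall n, measurable_fun setT (fun z => pr (s n z))) ->
    exists2 f : plane R -> R, measurable_fun setT f &
    forall n, (\int[mu]_x ((f x - pr (s n x)) ^+ 2)%:E <= (4 / n.+1%:R)%:E)%E.
  move=> prle prB ms; apply: (square_integrable_complete ms) => n m nm.
  apply: le_trans (_ : ((rip (s m - s n) (s m - s n))%:E <= _)%E); last first.
    by rewrite lee_fin sle.
  rewrite rip_sqn; last exact: L2B.
  apply: ge0_le_integral => //.
  - by move=> z _; rewrite lee_fin sqr_ge0.
  - by apply/measurable_EFinP; apply: measurable_funX; exact: measurable_funB.
  - by apply/measurable_EFinP; apply: measurable_sqn; apply: L2_cmeas; exact: L2B.
  - by move=> z _; rewrite lee_fin -prB prle.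
have [c|c c'|n|f1 mf1 f1s] := part (@complex.Re R).
- by rewrite /sqn lerDl sqr_ge0.
- by rewrite Re_addc Re_oppc.
- by case/L2_cmeas: (Ls n).
have [c|c c'|n|f2 mf2 f2s] := part (@complex.Im R).
- by rewrite /sqn lerDr sqr_ge0.
- by rewrite Im_addc Im_oppc.
- by case/L2_cmeas: (Ls n).
pose p z := f1 z +i* f2 z.
have ms n : cmeas (p - s n).
  apply: cmeasD; first by split.
  by apply: L2_cmeas; exact: L2N.
have ps n : (\int[mu]_z (sqn ((p - s n) z))%:E <= (8 / n.+1%:R)%:E)%E.
  rewrite (_ : 8 / n.+1%:R = 4 / n.+1%:R + 4 / n.+1%:R);
    last by rewrite -mulrDl; congr (_ / _); ring.
  rewrite EFinD; apply: le_trans (leeD (f1s n) (f2s n)).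
  rewrite -ge0_integralD//.
  - apply: ge0_le_integral => //.
    + by move=> z _; rewrite lee_fin sqn_ge0.
    + by apply/measurable_EFinP; apply: measurable_sqn.
    + apply: emeasurable_funD; apply/measurable_EFinP; apply: measurable_funX;
        by apply: measurable_funB => //; case/L2_cmeas: (Ls n).
    + by move=> z _; rewrite -EFinD lee_fin /sqn Re_addc Im_addc Re_oppc Im_oppc.
  - by move=> z _; rewrite lee_fin sqr_ge0.
  - by apply/measurable_EFinP; apply: measurable_funX; apply: measurable_funB => //;
      case/L2_cmeas: (Ls n).
  - by move=> z _; rewrite lee_fin sqr_ge0.
  - by apply/measurable_EFinP; apply: measurable_funX; apply: measurable_funB => //;
      case/L2_cmeas: (Ls n).
have Lps n : L2 (p - s n) by apply/L2P; split=> //; exact: le_lt_trans (ps n) (ltry _).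
exists p; first by rewrite -(subrK (s 0%N) p); exact: L2D.
move=> e e0; have [N _ HN] := near_infty_natSinv_lt (PosNum (divr_gt0 e0 (ltr0n R 8))).
exists N => n /HN/= h; rewrite -lte_fin rip_sqn//; apply: le_lt_trans (ps n) _.
by rewrite lte_fin mulrC -ltr_pdivlMr.
Qed.

Lemma L2_rscale a f : L2 f -> L2 (rscale a f). Proof. exact: L2Z. Qed.

Lemma rip_CauchySchwarz f g : L2 f -> L2 g -> rip f g ^+ 2 <= rip f f * rip g g.
Proof.
exact: (form_CauchySchwarz L2D L2N L2_rscale ripC ripD ripN ripZ rip_ge0).
Qed.

Lemma rip_sqrD f g : L2 f -> L2 g -> rip (f + g) (f + g) = rip f f + 2 * rip f g + rip g g.
Proof. exact: (form_sqrD L2D ripC ripD). Qed.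

Lemma rip_sqrD_le f g : L2 f -> L2 g -> rip (f + g) (f + g) <= 2 * rip f f + 2 * rip g g.
Proof.
move=> Lf Lg; have := rip_ge0 (f - g); rewrite (form_sqrB L2D L2N ripC ripD ripN)//.
by rewrite rip_sqrD//; lra.
Qed.

Lemma rip_limit_eq0 r s : L2 r -> L2 s ->
  (forall e, 0 < e -> exists t, [/\ L2 t, rip r t = 0 & rip (s - t) (s - t) < e]) ->
  rip r s = 0.
Proof. exact: (orthogonal_limit L2D L2N L2_rscale ripC ripD ripN ripZ rip_ge0). Qed.

Lemma L2closureP S f : S `<=` @L2 R ->
  L2closure S f <-> L2 f /\
    forall e, 0 < e -> exists2 g, S g & rip (f - g) (f - g) < e.
Proof.
move=> SL; split=> -[Lf fS]; split=> // e e0.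
  have [g Sg] := fS (Num.sqrt e) (ltac:(by rewrite sqrtr_gt0)).
  rewrite norm2_lt ?sqrtr_gt0 ?sqr_sqrtr ?ltW//; first by exists g.
  by apply: L2B => //; exact: SL.
have [g Sg h] := fS (e ^+ 2) (exprn_gt0 _ e0); exists g => //.
by rewrite norm2_lt//; apply: L2B => //; exact: SL.
Qed.

Lemma L2_projection (S : set (plane R -> R[i])) : S 0 -> S `<=` @L2 R ->
  (forall u v, S u -> S v -> S (u + v)) -> (forall a u, S u -> S (rscale a u)) ->
  forall g, L2 g -> exists2 p, L2closure S p & forall s, S s -> rip (g - p) s = 0.
Proof.
move=> S0 SL SD SZ g Lg.
have [p [Lp pS gp]] := projection_exists L2D L2N L2_rscale ripC ripD ripN ripZ
  rip_ge0 L2_complete S0 SL SD SZ Lg.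
by exists p => //; apply/L2closureP.
Qed.

End L2_structure.

(** * Density of polynomials *)
Section step_approximation.
Context (R : realType).
Implicit Types s u : R.

(* At [u = (1 - s) / 2] the quantity [n 2^n u^n = n (1 - s)^n] tends to 0 when
   [s > 0] and is at least [n] when [s <= 0], hence the exponent. *)
Definition step_approx (n : nat) s : R := (1 - ((1 - s) / 2) ^+ n) ^+ (n * 2 ^ n).

Lemma bernoulli_le (k : nat) (u : R) : 0 <= u <= 1 -> 1 - k%:R * u <= (1 - u) ^+ k.
Proof.
move=> /andP[u0 u1]; elim: k => [|k IH]; first by rewrite mul0r subr0 expr0.
rewrite exprS; apply: le_trans (_ : (1 - u) * (1 - k%:R * u) <= _); last first.
  by rewrite ler_wpM2l// subr_ge0.
have : 0 <= k%:R * u ^+ 2 by rewrite mulr_ge0 ?sqr_ge0.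
by rewrite -natr1; nra.
Qed.

Lemma bernoulli_ge (k : nat) (u : R) : 0 <= u <= 1 -> (1 - u) ^+ k * (1 + k%:R * u) <= 1.
Proof.
move=> /andP[u0 u1]; elim: k => [|k IH]; first by rewrite mul0r addr0 mulr1 expr0.
apply: le_trans IH; rewrite exprSr -mulrA ler_wpM2l ?exprn_ge0 ?subr_ge0//.
have : 0 <= k%:R * u ^+ 2 by rewrite mulr_ge0 ?sqr_ge0.
by rewrite -natr1; have := sqr_ge0 u; nra.
Qed.

Lemma half_diff_itv s : -1 <= s <= 1 -> 0 <= (1 - s) / 2 <= 1.
Proof. by move=> /andP[s1 s2]; apply/andP; split; lra. Qed.

Lemma step_approx_itv n s : -1 <= s <= 1 -> 0 <= step_approx n s <= 1.
Proof.
move=> /half_diff_itv/andP[u0 u1]; rewrite /step_approx.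
by rewrite exprn_ge0 ?exprn_ile1 ?subr_ge0 ?exprn_ile1// lerBlDr lerDl exprn_ge0.
Qed.

Lemma natmul_geometric_le (r : R) (n : nat) : 0 <= r < 1 ->
  n.+1%:R * r ^+ n.+1 <= 4 / (1 - r) ^+ 2 * n.+1%:R^-1.
Proof.
move=> /andP[r0 r1]; set N : R := n.+1%:R.
have N0 : 0 < N by rewrite ltr0n.
have d0 : 0 < 1 - r by rewrite subr_gt0.
have h : r ^+ n.+1 <= expR (- (N * (1 - r))).
  rewrite -mulrN mulrC expRM_natr lerXn2r// ?nnegrE ?expR_ge0//.
  by apply: le_trans (expR_ge1Dx _); lra.
have g : (N * (1 - r)) ^+ 2 / 4 <= expR (N * (1 - r)).
  set y := N * (1 - r); have y0 : 0 <= y by rewrite mulr_ge0 ?ltW.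
  have -> : y = y / 2 * 2%:R by field.
  rewrite expRM_natr (_ : _ / 4 = (y / 2) ^+ 2); last by field.
  rewrite lerXn2r// ?nnegrE ?expR_ge0 ?divr_ge0//.
  by apply: le_trans (expR_ge1Dx _); lra.
apply: le_trans (ler_wpM2l (ltW N0) h) _; rewrite expRN.
have p0 : 0 < (N * (1 - r)) ^+ 2 / 4 by rewrite divr_gt0// exprn_gt0// mulr_gt0.
apply: le_trans (_ : N * ((N * (1 - r)) ^+ 2 / 4)^-1 <= _).
  by apply: ler_wpM2l; [exact: ltW|rewrite lef_pV2 ?posrE ?expR_gt0].
rewrite le_eqVlt; apply/orP; left; apply/eqP; field.
by rewrite !gt_eqF.
Qed.

Lemma step_approx_cvg s : -1 <= s <= 1 ->
  step_approx n s @[n --> \oo] --> ((0 < s)%R%:R : R).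
Proof.
move=> s11; have u01 := half_diff_itv s11.
have un01 n : 0 <= ((1 - s) / 2) ^+ n <= 1.
  by case/andP: u01 => u0 u1; rewrite exprn_ge0// exprn_ile1.
have kE n : (n * 2 ^ n)%:R * ((1 - s) / 2) ^+ n = n%:R * (1 - s) ^+ n :> R.
  rewrite natrM natrX -mulrA -exprMn; congr (_ * _ ^+ _); by field.
have inv0 : (n.+1%:R^-1 : R) @[n --> \oo] --> 0 by exact: cvg_harmonic.
rewrite -cvg_shiftS.
have [s0|s0] := ltP 0 s.
  apply: (@squeeze_cvgr _ _ _ _
    (fun n => 1 - 4 / (1 - (1 - s)) ^+ 2 * n.+1%:R^-1) (cst 1)).
  - apply: nearW => n; have /andP[_ ->] := step_approx_itv n.+1 s11; rewrite andbT.
    apply: le_trans (bernoulli_le _ (un01 _)); rewrite kE lerB//.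
    by apply: natmul_geometric_le; case/andP: s11 => ? ?; apply/andP; split; lra.
  - rewrite -[X in _ --> X]subr0; apply: cvgB; first exact: cvg_cst.
    by rewrite -[X in _ --> X](mulr0 (4 / (1 - (1 - s)) ^+ 2)); apply: cvgMl_tmp.
  - exact: cvg_cst.
apply: (@squeeze_cvgr _ _ _ _ (cst 0) (fun n => n.+1%:R^-1)) => //; last exact: cvg_cst.
apply: nearW => n; have /andP[-> _] /= := step_approx_itv n.+1 s11.
have := bernoulli_ge (n.+1 * 2 ^ n.+1) (un01 n.+1); rewrite kE => h.
have p0 : 0 < 1 + n.+1%:R * (1 - s) ^+ n.+1.
  by rewrite ltr_wpDr// mulr_ge0// exprn_ge0//; lra.
rewrite -ler_pdivlMr// div1r in h; apply: le_trans h _.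
rewrite lef_pV2 ?posrE// ?ltr0n//.
have : 1 <= (1 - s) ^+ n.+1 by rewrite exprn_ege1//; lra.
move=> h1; rewrite ler_wpDl// ler_peMr//.
Qed.

End step_approximation.

Section polynomial_density.
Context (R : realType).
Implicit Types (z : plane R) (p q phi psi : plane R -> R).
Local Notation mu := (@gauss R).

Inductive rpoly : (plane R -> R) -> Prop :=
| rpoly_cst c : rpoly (fun=> c)
| rpoly_fst : rpoly (fun z => z.1)
| rpoly_snd : rpoly (fun z => z.2)
| rpolyD p q : rpoly p -> rpoly q -> rpoly (fun z => p z + q z)
| rpolyM p q : rpoly p -> rpoly q -> rpoly (fun z => p z * q z).

Lemma rpolyX p n : rpoly p -> rpoly (fun z => p z ^+ n).
Proof.
move=> rp; elim: n => [|n IH]; first exact: rpoly_cst.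
rewrite (_ : (fun z => _) = fun z => p z * p z ^+ n); first exact: rpolyM.
by apply/funext => z; rewrite exprS.
Qed.

Lemma rpoly_sum n (F : nat -> plane R -> R) : (forall i, rpoly (F i)) ->
  rpoly (fun z => \sum_(0 <= i < n) F i z).
Proof.
move=> rF; elim: n => [|n IH].
  by rewrite (_ : (fun z => _) = fun=> 0); [exact: rpoly_cst|apply/funext => z; rewrite big_nil].
rewrite (_ : (fun z => _) = fun z => \sum_(0 <= i < n) F i z + F n z); first exact: rpolyD.
by apply/funext => z; rewrite big_nat_recr.
Qed.

Lemma measurable_rpoly p : rpoly p -> measurable_fun setT p.
Proof.
elim=> [c| | |p1 q1 _ mp _ mq|p1 q1 _ mp _ mq].
- exact: measurable_cst.
- exact: measurable_fst.
- exact: measurable_snd.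
- exact: measurable_funD.
- exact: measurable_funM.
Qed.

Definition expabs (c : R) z : R := expR (c * `|z.1|) * expR (c * `|z.2|).

Lemma expabs_gt0 c z : 0 < expabs c z.
Proof. by rewrite mulr_gt0 ?expR_gt0. Qed.

Lemma expabsD c d z : expabs (c + d) z = expabs c z * expabs d z.
Proof. by rewrite /expabs !mulrDl !expRD; ring. Qed.

Lemma expabs_ge1 c z : 0 <= c -> 1 <= expabs c z.
Proof.
by move=> c0; rewrite /expabs -expRD -expR0 ler_expR addr_ge0 ?mulr_ge0.
Qed.

Lemma expabs_le c d z : c <= d -> expabs c z <= expabs d z.
Proof.
move=> cd; rewrite -(subrK c d) expabsD ler_peMl ?(ltW (expabs_gt0 _ _))//.
by rewrite expabs_ge1// subr_ge0.
Qed.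

Lemma expabs_integrable c : mu.-integrable setT (EFin \o expabs c).
Proof.
apply/integrableP; split.
  by apply/measurable_EFinP; apply: measurable_funM; apply: measurableT_comp => //;
    apply: measurable_funM => //; apply: measurableT_comp.
under eq_integral do rewrite gee0_abs ?lee_fin ?(ltW (expabs_gt0 _ _))//.
exact: integral_gauss_expR_lty.
Qed.

(* The dominating function is square integrable for the Gaussian measure, so
   that orthogonality to polynomials passes to tame functions. *)
Definition tame phi := exists (p : nat -> plane R -> R) (K c : R),
  [/\ forall n, rpoly (p n), 0 <= c, forall n z, `|p n z| <= K * expabs c z &
      forall z, p n z @[n --> \oo] --> phi z].

Lemma tame_cst c : tame (fun=> c).
Proof.
exists (fun _ _ => c), `|c|, 0; split=> //; first by move=> n; exact: rpoly_cst.
- by move=> n z; rewrite ler_peMr// expabs_ge1.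
- by move=> z; exact: cvg_cst.
Qed.

Lemma tameD phi psi : tame phi -> tame psi -> tame (fun z => phi z + psi z).
Proof.
move=> [p [K [c [rp c0 pK pphi]]]] [q [L [d [rq d0 qL qpsi]]]].
have K0 : 0 <= K.
  have := le_trans (normr_ge0 _) (pK 0%N (0, 0)).
  by rewrite pmulr_lge0// expabs_gt0.
have L0 : 0 <= L.
  have := le_trans (normr_ge0 _) (qL 0%N (0, 0)).
  by rewrite pmulr_lge0// expabs_gt0.
exists (fun n z => p n z + q n z), (K + L), (c + d); split.
- by move=> n; exact: rpolyD.
- exact: addr_ge0.
- move=> n z; apply: le_trans (ler_normD _ _) _; rewrite mulrDl lerD//.
    by apply: le_trans (pK n z) _; rewrite ler_wpM2l// expabs_le// lerDl.
  by apply: le_trans (qL n z) _; rewrite ler_wpM2l// expabs_le// lerDr.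
- by move=> z; apply: cvgD.
Qed.

Lemma tameM phi psi : tame phi -> tame psi -> tame (fun z => phi z * psi z).
Proof.
move=> [p [K [c [rp c0 pK pphi]]]] [q [L [d [rq d0 qL qpsi]]]].
exists (fun n z => p n z * q n z), (K * L), (c + d); split.
- by move=> n; exact: rpolyM.
- exact: addr_ge0.
- by move=> n z; rewrite normrM expabsD mulrACA ler_pM.
- by move=> z; apply: cvgM.
Qed.

Lemma tameX phi n : tame phi -> tame (fun z => phi z ^+ n).
Proof.
move=> tp; elim: n => [|n IH]; first exact: tame_cst.
rewrite (_ : (fun z => _) = fun z => phi z * phi z ^+ n); first exact: tameM.
by apply/funext => z; rewrite exprS.
Qed.

Lemma tameB phi psi : tame phi -> tame psi -> tame (fun z => phi z - psi z).
Proof.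
move=> tp /(tameM (tame_cst (-1))) tq; have := tameD tp tq.
by under eq_fun do rewrite mulN1r.
Qed.

Lemma series_sin_coeff_le (x : R) n : `|series (sin_coeff x) n| <= expR `|x|.
Proof.
apply: le_trans (ler_norm_sum _ _ _) _.
apply: (@le_trans _ _ (series (exp_coeff `|x|) n)).
  apply: ler_sum => i _; rewrite /sin_coeff /exp_coeff /= !normrM normfV !normrX.
  rewrite normrN1 expr1n mulr1 !normr_nat -mulrA.
  by rewrite ler_piMl ?divr_ge0 ?exprn_ge0// lern1; case: odd.
apply: nondecreasing_cvgn_le; last exact: is_cvg_series_exp_coeff.
by apply: nondecreasing_series => i _ _; rewrite exp_coeff_ge0.
Qed.

Lemma tame_sin (pr : plane R -> R) (a t : R) : rpoly pr ->
  (forall c z, 0 <= c -> expR (c * `|pr z|) <= expabs c z) ->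
  tame (fun z => sin (a * (pr z - t))).
Proof.
move=> rpr prle.
exists (fun n z => series (sin_coeff (a * (pr z - t))) n), (expR (`|a| * `|t|)), `|a|.
split=> // [n|n z|z]; last first.
- rewrite unlock; exact: is_cvg_series_sin_coeff.
- apply: le_trans (series_sin_coeff_le _ _) _.
  apply: (@le_trans _ _ (expR (`|a| * `|t|) * expR (`|a| * `|pr z|))).
    rewrite -expRD ler_expR normrM -mulrDr ler_wpM2l//.
    by rewrite [leRHS]addrC ler_normB.
  by rewrite ler_wpM2l ?expR_ge0// prle.
apply: (rpoly_sum _ (F := fun i z => sin_coeff (a * (pr z - t)) i)) => i.
rewrite (_ : (fun z => _) = fun z =>
    ((odd i)%:R * (-1) ^+ i.-1./2 / i`!%:R) * (a * (pr z - t)) ^+ i).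
  apply: rpolyM; first exact: rpoly_cst.
  apply: rpolyX; apply: rpolyM; first exact: rpoly_cst.
  by apply: rpolyD => //; exact: rpoly_cst.
by apply/funext => z /=; rewrite /sin_coeff/=; ring.
Qed.

Variable h : plane R -> R.
Hypothesis mh : measurable_fun setT h.
Hypothesis ih2 : mu.-integrable setT (fun z => (h z ^+ 2)%:E).
Hypothesis h_rpoly : forall p, rpoly p -> \int[mu]_z (h z * p z) = 0.

Definition annihilated phi := [/\ measurable_fun setT phi,
  mu.-integrable setT (fun z => (h z * phi z)%:E) & \int[mu]_z (h z * phi z) = 0].

Lemma h_expabs_integrable c : mu.-integrable setT (fun z => (h z * expabs c z)%:E).
Proof.
have := integrableD measurableT ih2 (expabs_integrable (c + c)).
apply: le_integrable => //.
  apply/measurable_EFinP; apply: measurable_funM => //.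
  by have /integrableP[/measurable_EFinP] := expabs_integrable c.
move=> z _ /=; rewrite lee_fin expabsD.
apply: (@le_trans _ _ (h z ^+ 2 + expabs c z * expabs c z)); last exact: ler_norm.
rewrite normrM -[h z ^+ 2]real_normK ?num_real// (gtr0_norm (expabs_gt0 _ _)).
have := sqr_ge0 (`|h z| - expabs c z); have := sqr_ge0 (`|h z| + expabs c z).
by rewrite !expr2; have := normr_ge0 (h z); have := expabs_gt0 c z; nra.
Qed.

Lemma annihilated_limit (phi_ : nat -> plane R -> R) phi (G : plane R -> R) :
  (forall n, measurable_fun setT (phi_ n)) ->
  (forall n, \int[mu]_z (h z * phi_ n z) = 0) ->
  (forall n z, `|phi_ n z| <= G z) ->
  mu.-integrable setT (fun z => (h z * G z)%:E) ->
  (forall z, phi_ n z @[n --> \oo] --> phi z) ->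
  annihilated phi.
Proof.
move=> mphi_ phi_0 phi_G iG cphi.
have mphi : measurable_fun setT phi.
  by apply: (measurable_fun_cvg mphi_) => z _; exact: cphi.
have mE psi : measurable_fun setT psi -> measurable_fun setT (fun z => (h z * psi z)%:E).
  by move=> mpsi; apply/measurable_EFinP; exact: measurable_funM.
have [|||||] := @dominated_convergence _ _ _ mu setT measurableT
  (fun n z => (h z * phi_ n z)%:E) (fun z => (h z * phi z)%:E) (fun z => (`|h z * G z|)%:E).
- by move=> n; exact: mE.
- exact: mE.
- apply: nearW => z _; apply: cvg_EFin; first exact: nearW.
  by apply: cvgMl_tmp; exact: cphi.
- by have := integrable_abse iG.
- apply: nearW => z n _ /=; rewrite lee_fin !normrM ler_wpM2l//.
  exact: le_trans (phi_G n z) (ler_norm _).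
move=> iphi _ c; split=> //; rewrite /Rintegral.
have -> : (\int[mu]_z (h z * phi z)%:E = 0)%E; last by [].
apply: cvg_unique c _ => //.
rewrite (_ : [sequence _]_n = cst 0%E); first exact: cvg_cst.
apply/funext => n; rewrite -[RHS](congr1 EFin (phi_0 n)) /Rintegral fineK//.
apply: integrable_fin_num => //; apply: le_integrable iG => //; first exact: mE.
move=> z _ /=; rewrite lee_fin !normrM ler_wpM2l//.
exact: le_trans (phi_G n z) (ler_norm _).
Qed.

Lemma tame_annihilated phi : tame phi -> annihilated phi.
Proof.
move=> [p [K [c [rp c0 pK pphi]]]].
apply: (@annihilated_limit p _ (fun z => K * expabs c z)) => //.
- by move=> n; exact: measurable_rpoly.
- by move=> n; exact: h_rpoly.
- have := integrableZl measurableT K (h_expabs_integrable c).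
  by apply: eq_integrable => // z _; rewrite /= -EFinM; congr (_%:E); ring.
Qed.

Lemma annihilated_bounded_limit (phi_ : nat -> plane R -> R) phi :
  (forall n, annihilated (phi_ n)) -> (forall n z, `|phi_ n z| <= 1) ->
  (forall z, phi_ n z @[n --> \oo] --> phi z) -> annihilated phi.
Proof.
move=> Zphi phi1 cphi; apply: (annihilated_limit (phi_ := phi_) (G := cst 1)) => //.
- by move=> n; case: (Zphi n).
- by move=> n; case: (Zphi n).
- have := h_expabs_integrable 0; apply: eq_integrable => // z _.
  by rewrite /expabs !mul0r expR0 !mulr1.
Qed.

Lemma annihilatedB phi psi : annihilated phi -> annihilated psi ->
  annihilated (fun z => phi z - psi z).
Proof.
move=> [mphi iphi phi0] [mpsi ipsi psi0]; split; first exact: measurable_funB.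
  have := integrableB measurableT iphi ipsi.
  by apply: eq_integrable => // z _; rewrite /= -EFinB mulrBr.
by under eq_Rintegral do rewrite mulrBr; rewrite RintegralB// phi0 psi0 subrr.
Qed.

Lemma annihilatedD phi psi : annihilated phi -> annihilated psi ->
  annihilated (fun z => phi z + psi z).
Proof.
move=> [mphi iphi phi0] [mpsi ipsi psi0]; split; first exact: measurable_funD.
  have := integrableD measurableT iphi ipsi.
  by apply: eq_integrable => // z _; rewrite /= -EFinD mulrDr.
by under eq_Rintegral do rewrite mulrDr; rewrite RintegralD// phi0 psi0 addr0.
Qed.

End polynomial_density.

Section annihilator_trivial.
Context (R : realType).
Variable h : plane R -> R.
Local Notation mu := (@gauss R).
Hypothesis mh : measurable_fun setT h.
Hypothesis ih2 : mu.-integrable setT (fun z => (h z ^+ 2)%:E).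
Hypothesis h_rpoly : forall p, rpoly p -> \int[mu]_z (h z * p z) = 0.
Local Notation Z := (annihilated h).

Let bounded_limit := annihilated_bounded_limit mh ih2.

Lemma tame_step_approx (pr : plane R -> R) (a t : R) n : rpoly pr ->
  (forall c z, 0 <= c -> expR (c * `|pr z|) <= expabs c z) ->
  tame (fun z => step_approx n (sin (a * (pr z - t)))).
Proof.
move=> rpr prle; apply/tameX/tameB; first exact: tame_cst.
apply: tameX; apply: tameM; last exact: tame_cst.
by apply: tameB; [exact: tame_cst|exact: tame_sin].
Qed.

Lemma expR_fst_le c (z : plane R) : 0 <= c -> expR (c * `|z.1|) <= expabs c z.
Proof.
by move=> c0; rewrite ler_peMr ?expR_ge0// -expR0 ler_expR mulr_ge0.
Qed.

Lemma expR_snd_le c (z : plane R) : 0 <= c -> expR (c * `|z.2|) <= expabs c z.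
Proof.
by move=> c0; rewrite ler_peMl ?expR_ge0// -expR0 ler_expR mulr_ge0.
Qed.

Lemma sin_itv (x : R) : -1 <= sin x <= 1.
Proof. by rewrite sin_geN1 sin_le1. Qed.

Lemma normr_unitM (x y : R) : 0 <= x <= 1 -> 0 <= y <= 1 -> `|x * y| <= 1.
Proof.
move=> /andP[x0 x1] /andP[y0 y1].
by rewrite ger0_norm ?mulr_ge0// mulr_ile1.
Qed.

Lemma bool_itv (b : bool) : 0 <= (b%:R : R) <= 1.
Proof. by case: b; rewrite ?lexx ?ler01. Qed.

Lemma annihilated_sin_gt0 (a s t : R) : Z (fun z : plane R =>
  (0 < sin (a * (z.1 - s)))%R%:R * (0 < sin (a * (z.2 - t)))%R%:R).
Proof.
apply: (bounded_limit (phi_ := fun n z =>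
  step_approx n (sin (a * (z.1 - s))) * step_approx n (sin (a * (z.2 - t))))).
- move=> n; apply: tame_annihilated => //; apply: tameM.
    by apply: tame_step_approx; [exact: rpoly_fst|exact: expR_fst_le].
  by apply: tame_step_approx; [exact: rpoly_snd|exact: expR_snd_le].
- by move=> n z; rewrite normr_unitM ?step_approx_itv ?sin_itv.
- by move=> z; apply: cvgM; apply: step_approx_cvg; exact: sin_itv.
Qed.

Lemma sin_gt0_cvg (x s : R) :
  ((0 < sin (n.+1%:R^-1 * (x - s)))%R%:R : R) @[n --> \oo] --> ((s < x)%R%:R : R).
Proof.
apply: cvg_near_cst.
have npos (y : R) : 0 < y -> \forall n \near \oo, n.+1%:R^-1 * y < pi.
  move=> y0; have [N _ HN] := near_infty_natSinv_lt (PosNum (divr_gt0 (pi_gt0 R) y0)).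
  by exists N => // n /HN /=; rewrite ltr_pdivlMr.
have [sx|xs|->] := ltgtP s x; last first.
- by apply: nearW => n; rewrite subrr mulr0 sin0 ltxx.
- have := npos (s - x); rewrite subr_gt0 => /(_ xs); apply: filterS => n npi.
  rewrite -opprB mulrN sinN oppr_gt0 ltNge ltW// sin_gt0_pi// npi andbT.
  by rewrite mulr_gt0 ?invr_gt0// subr_gt0.
- have := npos (x - s); rewrite subr_gt0 => /(_ sx); apply: filterS => n npi.
  by rewrite sin_gt0_pi// npi andbT mulr_gt0 ?invr_gt0// subr_gt0.
Qed.

Lemma annihilated_quadrant (s t : R) :
  Z (fun z : plane R => (s < z.1)%R%:R * (t < z.2)%R%:R).
Proof.
apply: (bounded_limit (phi_ := fun n z => (0 < sin (n.+1%:R^-1 * (z.1 - s)))%R%:R *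
  (0 < sin (n.+1%:R^-1 * (z.2 - t)))%R%:R)).
- by move=> n; exact: annihilated_sin_gt0.
- by move=> n z; rewrite normr_unitM ?bool_itv.
- by move=> z; apply: cvgM; exact: sin_gt0_cvg.
Qed.

Lemma natN_lt_cvg (x : R) : ((- n%:R < x)%R%:R : R) @[n --> \oo] --> (1 : R).
Proof.
apply: cvg_near_cst; exists (Num.trunc `|x|).+1 => // n /= xn.
rewrite (_ : - n%:R < x) // ltrNl; apply: le_lt_trans (ler_norm _) _.
rewrite normrN; apply: lt_le_trans (_ : (Num.trunc `|x|).+1%:R <= _).
  exact: truncnS_gt.
by rewrite ler_nat.
Qed.

Lemma annihilated_dynkin d (T : measurableType d) (G : set (set T))
    (pr : plane R -> T) (psi : plane R -> R) :
  measurable = <<s G >> -> setI_closed G -> (forall z, 0 <= psi z <= 1) -> Z psi ->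
  (forall A, G A -> Z (fun z => psi z * \1_A (pr z))) ->
  forall A, measurable A -> Z (fun z => psi z * \1_A (pr z)).
Proof.
move=> GE GI psi01 Zpsi ZG A; rewrite GE; move: A.
have ind01 (A : set T) z : 0 <= (\1_A (pr z) : R) <= 1 by rewrite indicE bool_itv.
apply: (dynkin_induction GE GI) => //.
- rewrite (_ : (fun z => _) = psi)//.
  by apply/funext => z; rewrite indicT mulr1.
- move=> A mA ZA; have := annihilatedB Zpsi ZA.
  rewrite (_ : (fun z => psi z - _) = fun z => psi z * \1_(~` A) (pr z))//.
  by apply/funext => z; rewrite !indicE in_setC; case: (_ \in A); rewrite /=; ring.
move=> F mF tF ZF.
have Zsum n : Z (fun z => psi z * \sum_(0 <= i < n) \1_(F i) (pr z)).
  elim: n => [|n IH].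
    have := annihilatedB Zpsi Zpsi.
    rewrite (_ : (fun z => _) = fun z => psi z * \sum_(0 <= i < 0) \1_(F i) (pr z))//.
    by apply/funext => z; rewrite subrr big_nil mulr0.
  have := annihilatedD IH (ZF n).
  rewrite (_ : (fun z => _) = fun z => psi z * \sum_(0 <= i < n.+1) \1_(F i) (pr z))//.
  by apply/funext => z; rewrite big_nat_recr//= mulrDr.
have sum_mem w k n : F k w -> \sum_(0 <= i < n) (\1_(F i) w : R) = (k < n)%N%:R.
  move=> Fkw; rewrite (eq_bigr (fun i => (i == k)%:R)); last first.
    move=> i _; rewrite indicE; congr (_%:R); congr nat_of_bool.
    apply/idP/eqP => [|->]; last exact/mem_set.
    by move=> /set_mem Fiw; apply: (tF i k) => //; exists w.
  elim: n => [|n IH]; first by rewrite big_nil.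
  by rewrite big_nat_recr//= IH -natrD ltnS; case: (ltngtP k n).
have sum_notin w n : (forall k, ~ F k w) -> \sum_(0 <= i < n) (\1_(F i) w : R) = 0.
  by move=> Fw; apply: big1 => i _; rewrite indicE memNset.
apply: (bounded_limit (phi_ := fun n z => psi z * \sum_(0 <= i < n) \1_(F i) (pr z))) => //.
  move=> n z; apply: normr_unitM => //.
  have [[k Fk]|/forallNP nF] := pselect (exists k, F k (pr z)).
    by rewrite (sum_mem _ k)// bool_itv.
  by rewrite sum_notin// lexx ler01.
move=> z; apply: cvgMl_tmp; apply: cvg_near_cst.
have [[k Fk]|/forallNP nF] := pselect (exists k, F k (pr z)).
  exists k.+1 => // n /= kn; rewrite (sum_mem _ k)// kn indicE mem_set//.
  by exists k.
apply: nearW => n; rewrite sum_notin// indicE memNset// => -[k _]; exact: nF.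
Qed.

Lemma setI_closed_rays : setI_closed (@RGenOInfty.G R).
Proof.
move=> _ _ [s ->] [t ->]; exists (Num.max s t).
apply/seteqP; split=> x /=; rewrite !in_itv/= !andbT gt_max.
  by move=> [-> ->].
by move=> /andP[].
Qed.

Let mR : @measurable _ (measurableTypeR R) = <<s @RGenOInfty.G R >>.
Proof. exact: RGenOInfty.measurableE. Qed.

Lemma annihilated_rectangle (A B : set (measurableTypeR R)) : measurable A -> measurable B ->
  Z (fun z : plane R => \1_A z.1 * \1_B z.2).
Proof.
move=> mA mB.
have half t : Z (fun z : plane R => (t < z.2)%R%:R * \1_A z.1).
  apply: (annihilated_dynkin mR setI_closed_rays (psi := fun z : plane R => (t < z.2)%R%:R)) => //.
  - by move=> z; exact: bool_itv.
  - apply: (bounded_limit (phi_ := fun n (z : plane R) => (- n%:R < z.1)%R%:R * (t < z.2)%R%:R)).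
    + by move=> n; exact: annihilated_quadrant.
    + by move=> n z; rewrite normr_unitM ?bool_itv.
    + move=> z; rewrite -[X in _ --> X]mul1r; apply: cvgM; first exact: natN_lt_cvg.
      exact: cvg_cst.
  - move=> _ [s ->]; have := annihilated_quadrant s t.
    rewrite (_ : (fun z => _) = fun z : plane R => (t < z.2)%R%:R * \1_(`]s, +oo[%classic) z.1)//.
    by apply/funext => z; rewrite mulrC indicE mem_setE in_itv/= andbT.
apply: (annihilated_dynkin mR setI_closed_rays (psi := fun z : plane R => \1_A z.1)) => //.
- by move=> z; rewrite indicE; exact: bool_itv.
- apply: (bounded_limit (phi_ := fun n (z : plane R) => (- n%:R < z.2)%R%:R * \1_A z.1)).
  + by move=> n; exact: half.
  + by move=> n z; rewrite indicE normr_unitM ?bool_itv.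
  + move=> z; rewrite -[X in _ --> X]mul1r; apply: cvgM; first exact: natN_lt_cvg.
    exact: cvg_cst.
- move=> _ [s ->]; have := half s.
  rewrite (_ : (fun z => _) = fun z : plane R => \1_A z.1 * \1_(`]s, +oo[%classic) z.2)//.
  by apply/funext => z; rewrite mulrC; congr (_ * _); rewrite indicE mem_setE in_itv/= andbT.
Qed.

Lemma annihilated_indic (A : set (plane R)) : measurable A -> Z (\1_A).
Proof.
move=> mA.
have Z1 : Z (fun=> 1) by apply: tame_annihilated => //; exact: tame_cst.
have := @annihilated_dynkin _ (plane R) _ idfun (fun=> 1)
  (@measurable_prod_measurableType _ _ (measurableTypeR R) (measurableTypeR R)).
rewrite (_ : \1_A = fun z => 1 * \1_A (idfun z)); last first.
  by apply/funext => z; rewrite mul1r.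
apply=> //.
- move=> _ _ [A1 mA1 [B1 mB1 <-]] [A2 mA2 [B2 mB2 <-]].
  exists (A1 `&` A2); first exact: measurableI.
  by exists (B1 `&` B2); [exact: measurableI|rewrite setXI].
- by move=> z; rewrite lexx ler01.
- move=> _ [A1 mA1 [B1 mB1 <-]]; have := annihilated_rectangle mA1 mB1.
  rewrite (_ : (fun z => _) = fun z => 1 * \1_(A1 `*` B1) (idfun z))//.
  by apply/funext => -[x y]; rewrite mul1r !indicE/= in_setX -natrM mulnb.
Qed.

Lemma annihilator_eq0 : {ae mu, forall z, h z = 0}.
Proof.
have ih : mu.-integrable setT (EFin \o h).
  have := h_expabs_integrable mh ih2 0; apply: eq_integrable => // z _.
  by rewrite /= /expabs !mul0r expR0 !mulr1.
have : ae_eq mu setT (EFin \o h) (cst 0%E).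
  apply: integral_ae_eq => // A _ mA; rewrite integral0.
  have [_ iA iA0] := annihilated_indic mA; move: (congr1 EFin iA0).
  rewrite /Rintegral fineK ?integrable_fin_num// => iA0'.
  rewrite -[RHS]iA0' integral_mkcond; apply: eq_integral => z _.
  by rewrite patchE indicE; case: ifPn => _; rewrite /= ?mulr1 ?mulr0.
by apply: filterS => z /(_ I) /= [].
Qed.

End annihilator_trivial.

Section complex_polynomials.
Context (R : realType).
Local Notation mu := (@gauss R).
Local Notation Re := complex.Re.
Local Notation Im := complex.Im.

Inductive zpoly : (plane R -> R[i]) -> Prop :=
| zpoly_mono c a b : zpoly (fun z => c * toC z ^+ a * (toC z)^* ^+ b)
| zpolyD p q : zpoly p -> zpoly q -> zpoly (fun z => p z + q z).

Lemma zpoly_monoM c a b p : zpoly p ->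
  zpoly (fun z => c * toC z ^+ a * (toC z)^* ^+ b * p z).
Proof.
elim=> [c' a' b'|p1 p2 _ h1 _ h2].
  rewrite (_ : (fun z => _) = fun z => (c * c') * toC z ^+ (a + a') * (toC z)^* ^+ (b + b')).
    exact: zpoly_mono.
  by apply/funext => z; rewrite !exprD; ring.
by under eq_fun do rewrite mulrDr; exact: zpolyD.
Qed.

Lemma zpolyM p q : zpoly p -> zpoly q -> zpoly (fun z => p z * q z).
Proof.
move=> + zq; elim=> [c a b|p1 p2 _ h1 _ h2]; first exact: zpoly_monoM.
by under eq_fun do rewrite mulrDl; exact: zpolyD.
Qed.

Lemma zpoly_cst c : zpoly (fun=> c).
Proof.
have := zpoly_mono c 0 0; rewrite (_ : (fun z => _) = fun=> c)//.
by apply/funext => z; rewrite !expr0 !mulr1.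
Qed.

Lemma zpolyZ c p : zpoly p -> zpoly (fun z => c * p z).
Proof. exact/zpolyM/zpoly_cst. Qed.

Lemma zpoly_rpoly p : rpoly p -> zpoly (fun z => (p z)%:C).
Proof.
have zw : zpoly (fun z => toC z).
  have := zpoly_mono 1 1 0; rewrite (_ : (fun z => _) = fun z => toC z)//.
  by apply/funext => z; rewrite expr0 mulr1 mul1r.
have zwc : zpoly (fun z => (toC z)^*).
  have := zpoly_mono 1 0 1; rewrite (_ : (fun z => _) = fun z => (toC z)^*)//.
  by apply/funext => z; rewrite expr0 mul1r expr1 mul1r.
elim=> [c| | |p1 p2 _ h1 _ h2|p1 p2 _ h1 _ h2].
- exact: zpoly_cst.
- have := zpolyD (zpolyZ (2^-1)%:C zw) (zpolyZ (2^-1)%:C zwc).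
  rewrite (_ : (fun z => _) = fun z => (z.1)%:C)//.
  by apply/funext => z; apply/eqP; rewrite /toC eq_complex/=; apply/andP; split; apply/eqP; field.
- have := zpolyD (zpolyZ (0 -i* 2^-1) zw) (zpolyZ (0 +i* 2^-1) zwc).
  rewrite (_ : (fun z => _) = fun z => (z.2)%:C)//.
  by apply/funext => z; apply/eqP; rewrite /toC eq_complex/=; apply/andP; split; apply/eqP; field.
- by under eq_fun do rewrite rmorphD; exact: zpolyD.
- by under eq_fun do rewrite rmorphM; exact: zpolyM.
Qed.

Lemma rpoly_dominated (p : plane R -> R) : rpoly p ->
  exists K c : R, 0 <= c /\ forall z, `|p z| <= K * expabs c z.
Proof.
have normr_le_expR (x : R) : `|x| <= expR (1 * `|x|).
  by rewrite mul1r; apply: le_trans (expR_ge1Dx _); lra.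
elim=> [c| | |p1 p2 _ [K [c [c0 h1]]] _ [L [d [d0 h2]]]|p1 p2 _ [K [c [c0 h1]]] _ [L [d [d0 h2]]]].
- by exists `|c|, 0; split=> // z; rewrite ler_peMr// expabs_ge1.
- exists 1, 1; split=> // z; rewrite mul1r.
  by apply: le_trans (normr_le_expR _) _; exact: expR_fst_le.
- exists 1, 1; split=> // z; rewrite mul1r.
  by apply: le_trans (normr_le_expR _) _; exact: expR_snd_le.
- exists (`|K| + `|L|), (c + d); split; first exact: addr_ge0.
  move=> z; apply: le_trans (ler_normD _ _) _; rewrite mulrDl lerD//.
    apply: le_trans (h1 z) _; apply: (@le_trans _ _ (`|K| * expabs c z)).
      by rewrite ler_wpM2r ?(ltW (expabs_gt0 _ _))// ler_norm.
    by rewrite ler_wpM2l// expabs_le// lerDl.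
  apply: le_trans (h2 z) _; apply: (@le_trans _ _ (`|L| * expabs d z)).
    by rewrite ler_wpM2r ?(ltW (expabs_gt0 _ _))// ler_norm.
  by rewrite ler_wpM2l// expabs_le// lerDr.
- exists (K * L), (c + d); split; first exact: addr_ge0.
  by move=> z; rewrite normrM expabsD mulrACA ler_pM.
Qed.

Lemma rpoly_integrable (p : plane R -> R) : rpoly p -> mu.-integrable setT (EFin \o p).
Proof.
move=> rp; have [K [c [c0 pK]]] := rpoly_dominated rp.
have := integrableZl measurableT K (expabs_integrable c); apply: le_integrable => //.
  by apply/measurable_EFinP; exact: measurable_rpoly.
by move=> z _ /=; rewrite lee_fin; apply: le_trans (pK z) (ler_norm _).
Qed.

Definition rpoly_parts (p : plane R -> R[i]) :=
  rpoly (fun z => Re (p z)) /\ rpoly (fun z => Im (p z)).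

Lemma rpolyN (p : plane R -> R) : rpoly p -> rpoly (fun z => - p z).
Proof.
move=> rp; have := rpolyM (rpoly_cst (-1)) rp.
by under eq_fun do rewrite mulN1r.
Qed.

Lemma rpoly_partsM p q : rpoly_parts p -> rpoly_parts q -> rpoly_parts (fun z => p z * q z).
Proof.
move=> [p1 p2] [q1 q2]; split.
  by under eq_fun do rewrite Re_mulc; apply: rpolyD; [exact: rpolyM|apply/rpolyN/rpolyM].
by under eq_fun do rewrite Im_mulc; apply: rpolyD; exact: rpolyM.
Qed.

Lemma rpoly_partsX p n : rpoly_parts p -> rpoly_parts (fun z => p z ^+ n).
Proof.
move=> rp; elim: n => [|n IH]; first by split; exact: rpoly_cst.
by under eq_fun do rewrite exprS; exact: rpoly_partsM.
Qed.

Lemma zpoly_parts p : zpoly p -> rpoly_parts p.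
Proof.
elim=> [c a b|p1 p2 _ [h1 h1'] _ [h2 h2']].
  apply: rpoly_partsM; first apply: rpoly_partsM.
  - by split; exact: rpoly_cst.
  - by apply: rpoly_partsX; split; [exact: rpoly_fst|exact: rpoly_snd].
  - by apply: rpoly_partsX; split; [exact: rpoly_fst|exact/rpolyN/rpoly_snd].
by split; [under eq_fun do rewrite Re_addc|under eq_fun do rewrite Im_addc]; exact: rpolyD.
Qed.

Lemma zpoly_L2 p : zpoly p -> L2 p.
Proof.
move=> /zpoly_parts[rp1 rp2].
apply: (@L2_dominated _ _ (fun z => sqn (p z))) => //.
  by split; exact: measurable_rpoly.
by apply: rpoly_integrable; apply: rpolyD; exact: rpolyX.
Qed.

Lemma zpoly_dense f (e : R) : L2 f -> 0 < e ->
  exists2 p, zpoly p & rip (f - p) (f - p) < e.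
Proof.
move=> Lf e0.
have [p0 p0S orth] := @L2_projection R zpoly (zpoly_cst 0) zpoly_L2 zpolyD
  (fun a u => @zpolyZ a%:C u) f Lf.
have [Lp0 p0app] := (L2closureP p0 zpoly_L2).1 p0S.
pose r := f - p0; have Lr : L2 r by exact: L2B.
have [mr1 mr2] := L2_cmeas Lr.
have sq_int (pr : R[i] -> R) : (forall c, pr c ^+ 2 <= sqn c) ->
    measurable_fun setT (fun z => pr (r z)) ->
    mu.-integrable setT (fun z => (pr (r z) ^+ 2)%:E).
  move=> prle mpr; have := sqn_integrable Lr; apply: le_integrable => //.
    by apply/measurable_EFinP; exact: measurable_funX.
  by move=> z _ /=; rewrite lee_fin !ger0_norm ?sqr_ge0 ?sqn_ge0.
have r1 : {ae mu, forall z, Re (r z) = 0}.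
  apply: annihilator_eq0 => //; first by apply: sq_int => // c; rewrite lerDl sqr_ge0.
  move=> p rp; rewrite -(orth _ (zpoly_rpoly rp)).
  by apply: eq_Rintegral => z _; rewrite /redot/=; ring.
have r2 : {ae mu, forall z, Im (r z) = 0}.
  apply: annihilator_eq0 => //; first by apply: sq_int => // c; rewrite lerDr sqr_ge0.
  move=> p rp; rewrite -(orth _ (zpolyZ 'i (zpoly_rpoly rp))).
  by apply: eq_Rintegral => z _; rewrite /redot Re_mulc Im_mulc/=; ring.
have r0 : rip r r = 0.
  apply: ae_eq0_rip => //; move: r1 r2; apply: filterS2 => z.
  by case: (r z) => a b /= -> ->.
have [q zq qe] := p0app (e / 2) (divr_gt0 e0 (ltr0n _ 2)).
exists q => //; have Lq := zpoly_L2 zq.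
have -> : f - q = r + (p0 - q) by rewrite /r addrA subrK.
have := rip_sqrD_le Lr (L2B Lp0 Lq); rewrite r0; lra.
Qed.

End complex_polynomials.

(** * Ito-Hermite polynomials *)
Section hermite.
Context (R : realType).
Implicit Types z : plane R.

Lemma rising_neq0 (k m : nat) : (k <= m)%N -> rising (- m%:R : R) k != 0.
Proof.
move=> km; apply/prodf_neq0 => i _; rewrite addrC subr_eq0 eqr_nat neq_ltn.
by rewrite (leq_trans (ltn_ord i) km).
Qed.

Lemma rising_eq0 (k m : nat) : (m < k)%N -> rising (- m%:R : R) k = 0.
Proof.
by move=> mk; apply/eqP/prodf_eq0; exists (Ordinal mk) => //=; rewrite addNr.
Qed.

Lemma rising_gt0 (j k : nat) : 0 < rising (j.+1%:R : R) k.
Proof. by apply: prodr_gt0 => i _; rewrite -natrD. Qed.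

Lemma kummerE (m : nat) (b x : R) : kummer (- m%:R) b x =
  \sum_(0 <= k < m.+1) rising (- m%:R) k / rising b k * (x ^+ k / k`!%:R).
Proof.
apply: cvg_lim => //; apply: cvg_near_cst; exists m.+1 => // n /= mn.
rewrite /series/= (big_cat_nat (n := m.+1))//= [X in _ + X]big1_seq ?addr0// => k.
by rewrite mem_index_iota => /andP[_ /andP[mk _]]; rewrite rising_eq0// !mul0r.
Qed.

Lemma mul_conjc_sqmod z : toC z * (toC z)^* = (sqmod z)%:C.
Proof. by apply/eqP; rewrite eq_complex/= /sqmod; apply/andP; split; apply/eqP; ring. Qed.

(* [hermite_coef m j k] is the coefficient of [z^k conj(z)^(j + k)] in
   [hermite m (m + j)], and that of [z^(j + k) conj(z)^k] in
   [hermite (m + j) m]. *)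
Definition hermite_coef (m j k : nat) : R :=
  (-1) ^+ m * (m + j)`!%:R / j`!%:R * (rising (- m%:R) k / rising j.+1%:R k / k`!%:R).

Lemma hermite_coef_neq0 m j : hermite_coef m j m != 0.
Proof.
rewrite /hermite_coef !mulf_neq0 ?invr_eq0 ?signr_eq0 ?pnatr_eq0 -?lt0n ?fact_gt0//.
  exact: rising_neq0.
by rewrite gt_eqF// rising_gt0.
Qed.

Lemma mulCAC_real (a b c d : R) (w : R[i]) : a * b = c * d ->
  a%:C * w * b%:C = c%:C * w * d%:C.
Proof. by move=> h; rewrite mulrAC -rmorphM h rmorphM mulrAC. Qed.

Lemma hermite_leE m j z : hermite m (m + j) z =
  \sum_(0 <= k < m.+1) (hermite_coef m j k)%:C * toC z ^+ k * (toC z)^* ^+ (j + k).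
Proof.
rewrite /hermite leq_addr addKn kummerE rmorph_sum big_distrr/=.
apply: eq_bigr => k _; rewrite exprD.
rewrite (_ : _ * toC z ^+ k * _ =
    (hermite_coef m j k)%:C * (toC z)^* ^+ j * (toC z * (toC z)^*) ^+ k); last first.
  by rewrite exprMn; ring.
rewrite mul_conjc_sqmod -(rmorphXn (real_complex R)).
apply: mulCAC_real; rewrite /hermite_coef; ring.
Qed.

Lemma hermite_geE m j z : (0 < j)%N -> hermite (m + j) m z =
  \sum_(0 <= k < m.+1) (hermite_coef m j k)%:C * toC z ^+ (j + k) * (toC z)^* ^+ k.
Proof.
move=> j0; rewrite /hermite leqNgt -{1}(addn0 m) ltn_add2l j0/=.
rewrite addKn kummerE rmorph_sum big_distrr/=.
apply: eq_bigr => k _; rewrite exprD.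
rewrite (_ : _ * _ * (toC z)^* ^+ k =
    (hermite_coef m j k)%:C * toC z ^+ j * (toC z * (toC z)^*) ^+ k); last first.
  by rewrite exprMn; ring.
rewrite mul_conjc_sqmod -(rmorphXn (real_complex R)).
apply: mulCAC_real; rewrite /hermite_coef; ring.
Qed.

Inductive hspan : (plane R -> R[i]) -> Prop :=
| hspan_hermite c m n : hspan (fun z => c * hermite m n z)
| hspanD p q : hspan p -> hspan q -> hspan (fun z => p z + q z).

Lemma hspanZ c p : hspan p -> hspan (fun z => c * p z).
Proof.
elim=> [c' m n|p1 p2 _ h1 _ h2].
  by under eq_fun do rewrite mulrA; exact: hspan_hermite.
by under eq_fun do rewrite mulrDr; exact: hspanD.
Qed.

Lemma hspan_sum n (F : nat -> plane R -> R[i]) : (forall i, (i < n)%N -> hspan (F i)) ->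
  hspan (fun z => \sum_(0 <= i < n) F i z).
Proof.
elim: n => [_|n IH hF].
  have := hspan_hermite 0 0 0; rewrite (_ : (fun z => _) = fun z => \sum_(0 <= i < 0) F i z)//.
  by apply/funext => z; rewrite mul0r big_nil.
under eq_fun do rewrite big_nat_recr//=.
by apply: hspanD; [apply: IH => i /ltnW ni; exact: hF|exact: hF].
Qed.

(* The monomial of highest degree of a Hermite polynomial has a nonzero
   coefficient and the others are handled by induction. *)
Lemma hspan_mono a b : hspan (fun z => toC z ^+ a * (toC z)^* ^+ b).
Proof.
have aux j (P H : nat -> plane R -> R[i]) : (forall m, hspan (H m)) ->
    (forall m z, H m z = \sum_(0 <= k < m.+1) (hermite_coef m j k)%:C * P k z) ->
    forall m, hspan (P m).
  move=> hH HP m; elim/ltn_ind: m => m IH.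
  have -> : P m = fun z => (hermite_coef m j m)%:C^-1 *
      (H m z + \sum_(0 <= k < m) (- (hermite_coef m j k)%:C) * P k z).
    apply/funext => z; rewrite HP big_nat_recr//= addrAC -big_split/= big1 ?add0r.
      by rewrite mulrA mulVf ?mul1r// fmorph_eq0 hermite_coef_neq0.
    by move=> k _; rewrite mulNr addrN.
  apply/hspanZ/hspanD; first exact: hH.
  by apply: hspan_sum => k km; apply: hspanZ; exact: IH.
have hH m n : hspan (@hermite R m n).
  by have := hspan_hermite 1 m n; under eq_fun do rewrite mul1r.
have [ab|ba] := leqP a b.
  have := aux (b - a)%N (fun k z => toC z ^+ k * (toC z)^* ^+ (b - a + k))
    (fun m => hermite m (m + (b - a))) (fun m => hH _ _) _ a.
  rewrite subnK//; apply => m z.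
  by rewrite hermite_leE; apply: eq_bigr => k _; rewrite mulrA.
have := aux (a - b)%N (fun k z => toC z ^+ (a - b + k) * (toC z)^* ^+ k)
  (fun m => hermite (m + (a - b)) m) (fun m => hH _ _) _ b.
rewrite subnK 1?ltnW//; apply => m z.
by rewrite hermite_geE ?subn_gt0//; apply: eq_bigr => k _; rewrite mulrA.
Qed.

Lemma zpoly_hspan p : zpoly p -> hspan p.
Proof.
elim=> [c a b|p1 p2 _ h1 _ h2]; last exact: hspanD.
by under eq_fun do rewrite -mulrA; exact/hspanZ/hspan_mono.
Qed.

Lemma zpoly_sum n (F : nat -> plane R -> R[i]) : (forall i, zpoly (F i)) ->
  zpoly (fun z => \sum_(0 <= i < n) F i z).
Proof.
move=> hF; elim: n => [|n IH].
  by under eq_fun do rewrite big_nil; exact: zpoly_cst.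
by under eq_fun do rewrite big_nat_recr//=; exact: zpolyD.
Qed.

Lemma hermite_zpoly m n : zpoly (@hermite R m n).
Proof.
have [mn|nm] := leqP m n.
  rewrite -(subnKC mn) (funext (hermite_leE m _)).
  by apply: zpoly_sum => k; exact: zpoly_mono.
rewrite -(subnKC (ltnW nm)).
rewrite (_ : hermite _ _ = fun z => \sum_(0 <= k < n.+1)
  (hermite_coef n (m - n) k)%:C * toC z ^+ (m - n + k) * (toC z)^* ^+ k).
  by apply: zpoly_sum => k; exact: zpoly_mono.
by apply/funext => z; rewrite hermite_geE// subn_gt0.
Qed.

Definition turn_unit : R[i] := (3 / 5) +i* (4 / 5).

Lemma toC_turn z : toC (turn z) = turn_unit * toC z.
Proof.
by apply/eqP; rewrite eq_complex/=; apply/andP; split; apply/eqP; ring.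
Qed.

Lemma hermite_turn m n z : hermite m n (turn z) =
  (if (m <= n)%N then turn_unit^* ^+ (n - m) else turn_unit ^+ (m - n)) * hermite m n z.
Proof.
rewrite /hermite sqmod_turn toC_turn; case: ifP => _; last by rewrite exprMn; ring.
by rewrite (rmorphM (@conjc R)) exprMn; ring.
Qed.

End hermite.

(** * The weighted Cauchy transform *)
Section cauchy_kernel.
Context (R : realType).
Local Notation mu := (@gauss R).
Implicit Types z xi : plane R.

(* [|z - xi|^-1], with value 0 on the diagonal. *)
Definition ckernel z xi : R := (Num.sqrt (sqn (toC z - toC xi)))^-1.

Lemma ckernel_ge0 z xi : 0 <= ckernel z xi.
Proof. by rewrite invr_ge0 sqrtr_ge0. Qed.

Lemma ckernelC z xi : ckernel z xi = ckernel xi z.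
Proof. by rewrite /ckernel /sqn/=; congr (Num.sqrt _)^-1; ring. Qed.

Lemma sqn_diffE z xi : sqn (toC z - toC xi) = (z.1 - xi.1) ^+ 2 + (z.2 - xi.2) ^+ 2.
Proof. by []. Qed.

Lemma measurable_sqn_diff : measurable_fun setT
  (fun u : plane R * plane R => sqn (toC u.1 - toC u.2)).
Proof.
under eq_fun do rewrite sqn_diffE.
apply: measurable_funD; apply: measurable_funX; apply: measurable_funB;
  exact: measurableT_comp.
Qed.

Lemma measurable_ckernel : measurable_fun setT
  (fun u : plane R * plane R => ckernel u.1 u.2).
Proof.
rewrite (_ : (fun u => _) = (fun x : R => x `^ (- 2^-1)) \o
    (fun u : plane R * plane R => sqn (toC u.1 - toC u.2))).
  by apply: measurableT_comp; [exact: measurable_powR|exact: measurable_sqn_diff].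
by apply/funext => u /=; rewrite powRN powR12_sqrt ?sqn_ge0.
Qed.

Definition square z (j : nat) : set (plane R) :=
  `[z.1 - 2^-1 ^+ j, z.1 + 2^-1 ^+ j]%classic `*` `[z.2 - 2^-1 ^+ j, z.2 + 2^-1 ^+ j]%classic.

Lemma measurable_square z j : measurable (square z j).
Proof. by apply: measurableX; exact: measurable_itv. Qed.

Lemma gauss_le_area (A : set (plane R)) : measurable A -> (mu A <= area R A)%E.
Proof.
move=> mA; rewrite /gauss -[leRHS]mul1e -integral_cst//.
apply: ge0_le_integral => //.
- apply: measurable_funTS; apply/measurable_EFinP.
  by apply: measurableT_comp => //; apply: measurableT_comp => //; exact: measurable_sqmod.
- move=> z _; rewrite lee_fin -expR0 ler_expR oppr_le0.
  by rewrite addr_ge0 ?sqr_ge0.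
Qed.

Lemma area_square z j : area R (square z j) = (4 * 4^-1 ^+ j)%:E.
Proof.
have ho : 0 < 2^-1 ^+ j :> R by rewrite exprn_gt0.
have -> : area R (square z j) = (@lebesgue_measure R `[(z.1 - 2^-1 ^+ j)%R, (z.1 + 2^-1 ^+ j)%R] *
    @lebesgue_measure R `[(z.2 - 2^-1 ^+ j)%R, (z.2 + 2^-1 ^+ j)%R])%E.
  by apply: product_measure1E; exact: measurable_itv.
rewrite !lebesgue_measure_itv/= !lte_fin !ltrD2l gtrN// -!EFinB -EFinM; congr (_%:E).
rewrite (_ : 4^-1 = 2^-1 * 2^-1 :> R); last by field.
by rewrite exprMn; ring.
Qed.

Lemma inv_le_sum_squares z xi n :
  2^-1 ^+ n < Num.max `|z.1 - xi.1| `|z.2 - xi.2| ->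
  (Num.max `|z.1 - xi.1| `|z.2 - xi.2|)^-1 <=
    1 + \sum_(0 <= j < n) 2 ^+ j * \1_(square z j) xi.
Proof.
set m := Num.max _ _; elim: n => [|n IH] mn.
  rewrite expr0 in mn; rewrite big_nil addr0 invf_le1 ?ltW//.
  exact: lt_trans mn.
have [mn'|nm] := ltP (2^-1 ^+ n) m.
  apply: le_trans (IH mn') _; rewrite big_nat_recr//= addrA lerDl.
  by rewrite mulr_ge0 ?exprn_ge0// indicE.
have mem j : (j <= n)%N -> xi \in square z j.
  move=> jn; have : m <= 2^-1 ^+ j.
    by apply: le_trans nm _; rewrite ler_wiXn2l ?invr_ge0// invf_le1// ler1n.
  rewrite ge_max => /andP[m1 m2]; apply/mem_set; split; rewrite /= in_itv/=.
    by move: m1; rewrite ler_norml => /andP[? ?]; apply/andP; split; lra.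
  by move: m2; rewrite ler_norml => /andP[? ?]; apply/andP; split; lra.
rewrite big_nat (eq_bigr (fun j => 2 ^+ j)); last first.
  by move=> j /andP[_ jn]; rewrite indicE mem// mulr1.
rewrite -big_nat (_ : 1 + _ = 2 ^+ n.+1); last first.
  elim: n.+1 => [|k IHk]; first by rewrite big_nil addr0 expr0.
  by rewrite big_nat_recr//= addrA IHk exprS; ring.
by rewrite -[leRHS]invrK lef_pV2 ?posrE ?invr_gt0 ?exprn_gt0 -?exprVn ?ltW//
  (lt_trans _ mn) ?exprn_gt0.
Qed.

(* Dyadic majorant of the kernel, whose integral is bounded uniformly in [z]. *)
Lemma ckernel_le z xi : ((ckernel z xi)%:E <=
  1 + \sum_(0 <= j <oo) (2 ^+ j * \1_(square z j) xi)%:E)%E.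
Proof.
have sum0 j : (0 <= (2 ^+ j * \1_(square z j) xi)%:E :> \bar R)%E.
  by rewrite lee_fin mulr_ge0 ?exprn_ge0// indicE.
set m := Num.max `|z.1 - xi.1| `|z.2 - xi.2|.
have [m0|m0] := leP m 0.
  have : sqn (toC z - toC xi) = 0.
    move: m0; rewrite ge_max !normr_le0 => /andP[/eqP e1 /eqP e2].
    by rewrite sqn_diffE e1 e2 expr0n addr0.
  rewrite /ckernel => ->; rewrite sqrtr0 invr0.
  by rewrite adde_ge0// nneseries_ge0.
have [n mn] : exists n, 2^-1 ^+ n < m.
  have [N _ HN] := near_infty_natSinv_expn_lt (PosNum m0).
  by exists N; have := HN N (leqnn _) => /=; rewrite div1r exprVn.
apply: le_trans (_ : (m^-1)%:E <= _)%E.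
  rewrite lee_fin lef_pV2 ?posrE//; last first.
    rewrite sqrtr_gt0 sqn_diffE; move: m0; rewrite lt_max !normr_gt0.
    by case/orP => h; [rewrite ltr_pwDl|rewrite ltr_wpDl] => //;
      rewrite ?sqr_ge0// exprn_even_gt0//=.
  rewrite -(ger0_norm (ltW m0)) -sqrtr_sqr ler_wsqrtr// sqn_diffE /m.
  by rewrite maxEle; case: ifP => _; rewrite real_normK ?num_real// ?lerDl ?lerDr sqr_ge0.
apply: (le_trans (y := (1 + \sum_(0 <= j < n) 2 ^+ j * \1_(square z j) xi)%:E)).
  by rewrite lee_fin inv_le_sum_squares.
rewrite EFinD leeD2l// -sumEFin; exact: nneseries_lim_ge.
Qed.

Definition ckernel_bound : R := fine (mu setT) + 8.

Lemma ckernel_bound_gt0 : 0 < ckernel_bound.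
Proof. by rewrite ltr_wpDl// fine_ge0. Qed.

Lemma integral_ckernel_le z : (\int[mu]_xi (ckernel z xi)%:E <= ckernel_bound%:E)%E.
Proof.
pose G j (xi : plane R) : \bar R := (2 ^+ j * \1_(square z j) xi)%:E.
have sum0 j xi : (0 <= G j xi)%E.
  by rewrite lee_fin mulr_ge0 ?exprn_ge0// indicE.
have mterm j : measurable_fun setT (G j).
  apply/measurable_EFinP; apply: measurable_funM => //.
  by apply: measurable_indic; exact: measurable_square.
have msum : measurable_fun setT (fun xi => \sum_(0 <= j <oo) G j xi)%E.
  by apply: ge0_emeasurable_sum => // *; exact: sum0.
apply: (@le_trans _ _ (\int[mu]_xi (1 + \sum_(0 <= j <oo) G j xi))%E).
  apply: ge0_le_integral => //.
  - by move=> xi _; rewrite lee_fin ckernel_ge0.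
  - apply/measurable_EFinP.
    exact: (measurableT_comp measurable_ckernel (measurable_pair1 z)).
  - exact: emeasurable_funD.
  - by move=> xi _; exact: ckernel_le.
rewrite ge0_integralD//; last by move=> xi _; exact: nneseries_ge0.
rewrite integral_cst// mul1e /ckernel_bound EFinD fineK ?fin_num_measure//.
rewrite leeD2l// integral_nneseries//.
apply: (@le_trans _ _ (\sum_(0 <= j <oo) (8 / (2 ^ (j + 1))%:R)%:E)%E); last first.
  have := @cvg_geometric_eseries_half R 8 0; rewrite expr0 divr1 => h.
  by move/cvg_lim : h => <-.
apply: lee_nneseries => [j _ _|j _]; first exact: integral_ge0.
rewrite /G; under eq_integral do rewrite EFinM.
rewrite ge0_integralZl//; last first.
  by apply/measurable_EFinP; apply: measurable_indic; exact: measurable_square.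
rewrite integral_indic//; last exact: measurable_square.
rewrite setIT; apply: (@le_trans _ _ ((2 ^+ j)%:E * (4 * 4^-1 ^+ j)%:E)%E).
  rewrite lee_pmul2l// ?lte_fin ?exprn_gt0// -(area_square z).
  by apply: gauss_le_area; exact: measurable_square.
rewrite -EFinM lee_fin addn1 natrX exprS (_ : 4^-1 = 2^-1 * 2^-1 :> R); last by field.
rewrite exprMn !exprVn le_eqVlt; apply/orP; left; apply/eqP; field.
by rewrite expf_neq0.
Qed.

End cauchy_kernel.

Section cintegral_theory.
Context (R : realType).
Local Notation mu := (@gauss R).
Local Notation Re := complex.Re.
Local Notation Im := complex.Im.
Implicit Types (F G : plane R -> R[i]).

Definition cintegrable F := mu.-integrable setT (fun z => (Re (F z))%:E) /\
  mu.-integrable setT (fun z => (Im (F z))%:E).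

Lemma eq_cintegral F G : F =1 G -> cintegral F = cintegral G.
Proof. by move=> /funext ->. Qed.

Lemma cintegralD F G : cintegrable F -> cintegrable G ->
  cintegral (fun z => F z + G z) = cintegral F + cintegral G.
Proof.
move=> [F1 F2] [G1 G2]; apply/eqP; rewrite eq_complex/= -!RintegralD//.
by apply/andP; split; apply/eqP; apply: eq_Rintegral => z _; rewrite ?Re_addc ?Im_addc.
Qed.

Lemma cintegrable_integrableZ (pr : R[i] -> R) c F : mu.-integrable setT (fun z => (pr (F z))%:E) ->
  mu.-integrable setT (EFin \o (fun z => c * pr (F z))).
Proof.
move=> iF; have := integrableZl measurableT c iF.
by apply: eq_integrable => // z _; rewrite /= -EFinM.
Qed.

Lemma cintegralZ c F : cintegrable F -> cintegral (fun z => c * F z) = c * cintegral F.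
Proof.
move=> [F1 F2]; apply/eqP; rewrite eq_complex Re_mulc Im_mulc/= -!RintegralZl//.
have i1 := cintegrable_integrableZ (Re c) F1; have i2 := cintegrable_integrableZ (Im c) F2.
have i3 := cintegrable_integrableZ (Re c) F2; have i4 := cintegrable_integrableZ (Im c) F1.
rewrite -RintegralB// -RintegralD//.
by apply/andP; split; apply/eqP; apply: eq_Rintegral => z _; rewrite ?Re_mulc ?Im_mulc.
Qed.

Lemma Rintegral_turn (f : plane R -> R) : measurable_fun setT f ->
  \int[mu]_z f (turn z) = \int[mu]_z f z.
Proof.
move=> mf; have mfE : measurable_fun setT (EFin \o f) by exact/measurable_EFinP.
rewrite /Rintegral [in LHS]integralE [in RHS]integralE.
have mp := measurable_funepos mfE; have mn := measurable_funeneg mfE.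
have := ge0_integral_gauss_turn mp (funepos_ge0 _).
have := ge0_integral_gauss_turn mn (funeneg_ge0 _) => hn hp.
rewrite -hn -hp; congr (fine (_ - _)); apply: eq_integral => z _.
  by rewrite !funeposE.
by rewrite !funenegE.
Qed.

Lemma cintegral_turn F : cmeas F -> cintegral (fun z => F (turn z)) = cintegral F.
Proof.
move=> [F1 F2]; rewrite /cintegral.
rewrite (Rintegral_turn (f := fun z => Re (F z)))//.
by rewrite (Rintegral_turn (f := fun z => Im (F z))).
Qed.

End cintegral_theory.

Section cauchy_bound.
Context (R : realType).
Local Notation mu := (@gauss R).
Local Notation Re := complex.Re.
Local Notation Im := complex.Im.
Implicit Types (f g : plane R -> R[i]) (z xi : plane R).
Local Notation K := (ckernel_bound R).

Definition cintegrand f z xi : R[i] := f xi / (toC z - toC xi).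

Lemma sqr_ckernel z xi : ckernel z xi ^+ 2 = (sqn (toC z - toC xi))^-1.
Proof. by rewrite /ckernel exprVn sqr_sqrtr// sqn_ge0. Qed.

Lemma sqn_cintegrand f z xi : sqn (cintegrand f z xi) = sqn (f xi) * ckernel z xi ^+ 2.
Proof.
rewrite /cintegrand sqnM sqr_ckernel; congr (_ * _).
case: (_ - _) => a b; rewrite /sqn/=.
have [->|s0] := eqVneq (a ^+ 2 + b ^+ 2) 0.
  by rewrite invr0 !mulr0 expr0n/= oppr0 expr0n addr0.
by field.
Qed.

Lemma ReV (c : R[i]) : Re c^-1 = Re c * (sqn c)^-1.
Proof. by case: c. Qed.

Lemma ImV (c : R[i]) : Im c^-1 = - (Im c * (sqn c)^-1).
Proof. by case: c. Qed.

Lemma measurable_cintegrand f : cmeas f ->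
  measurable_fun setT (fun u : plane R * plane R => Re (cintegrand f u.1 u.2)) /\
  measurable_fun setT (fun u : plane R * plane R => Im (cintegrand f u.1 u.2)).
Proof.
move=> [mf1 mf2].
have m1 : measurable_fun setT (fun u : plane R * plane R => Re (f u.2)).
  exact: (measurableT_comp mf1 measurable_snd).
have m2 : measurable_fun setT (fun u : plane R * plane R => Im (f u.2)).
  exact: (measurableT_comp mf2 measurable_snd).
have k1 : measurable_fun setT (fun u : plane R * plane R => Re (toC u.1 - toC u.2)^-1).
  rewrite (_ : (fun u => _) = fun u : plane R * plane R => (u.1.1 - u.2.1) * ckernel u.1 u.2 ^+ 2).
    apply: measurable_funM; last by apply: measurable_funX; exact: measurable_ckernel.
    by apply: measurable_funB; exact: measurableT_comp.
  by apply/funext => u; rewrite ReV sqr_ckernel.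
have k2 : measurable_fun setT (fun u : plane R * plane R => Im (toC u.1 - toC u.2)^-1).
  rewrite (_ : (fun u => _) = fun u : plane R * plane R =>
      - ((u.1.2 - u.2.2) * ckernel u.1 u.2 ^+ 2)).
    apply: measurable_funN; apply: measurable_funM; last first.
      by apply: measurable_funX; exact: measurable_ckernel.
    by apply: measurable_funB; exact: measurableT_comp.
  by apply/funext => u; rewrite ImV sqr_ckernel.
split.
  under eq_fun do rewrite Re_mulc.
  by apply: measurable_funB; exact: measurable_funM.
under eq_fun do rewrite Im_mulc.
by apply: measurable_funD; exact: measurable_funM.
Qed.

Lemma cmeas_cintegrand f z : cmeas f -> cmeas (cintegrand f z).
Proof.
move=> mf; have [m1 m2] := measurable_cintegrand mf.
split; [exact: (measurableT_comp m1 (measurable_pair1 z))|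
        exact: (measurableT_comp m2 (measurable_pair1 z))].
Qed.

Lemma measurable_Rintegral_param (g : plane R * plane R -> R) : measurable_fun setT g ->
  measurable_fun setT (fun z => \int[mu]_xi g (z, xi)).
Proof.
move=> mg; have mgE : measurable_fun setT (EFin \o g) by exact/measurable_EFinP.
have hp := measurable_fun_fubini_tonelli_F (m2 := mu) _ (measurable_funepos mgE) (funepos_ge0 _).
have hn := measurable_fun_fubini_tonelli_F (m2 := mu) _ (measurable_funeneg mgE) (funeneg_ge0 _).
apply: measurableT_comp => //; have := emeasurable_funB hp hn.
rewrite (_ : (fun z => _) = fun z => (\int[mu]_xi (g (z, xi))%:E)%E)//.
apply/funext => z; rewrite [RHS]integralE /fubini_F.
by congr (_ - _)%E; apply: eq_integral => xi _; rewrite ?funeposE ?funenegE.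
Qed.

Lemma cmeas_cauchy f : cmeas f -> cmeas (Defs.cauchy f).
Proof.
move=> mf; have [m1 m2] := measurable_cintegrand mf.
apply: cmeasM; first exact: cmeas_cst.
split; [exact: measurable_Rintegral_param m1|exact: measurable_Rintegral_param m2].
Qed.

Definition potential f z : \bar R := (\int[mu]_xi (sqn (f xi) * ckernel z xi)%:E)%E.

Lemma potential_ge0 f z : (0 <= potential f z)%E.
Proof. by apply: integral_ge0 => xi _; rewrite lee_fin mulr_ge0 ?sqn_ge0 ?ckernel_ge0. Qed.

Lemma measurable_ckernel1 z : measurable_fun setT (ckernel z).
Proof. exact: (measurableT_comp (@measurable_ckernel R) (measurable_pair1 z)). Qed.

Lemma ckernel_integrable z : mu.-integrable setT (fun xi => (ckernel z xi)%:E).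
Proof.
apply/integrableP; split; first by apply/measurable_EFinP; exact: measurable_ckernel1.
under eq_integral do rewrite gee0_abs ?lee_fin ?ckernel_ge0//.
exact: le_lt_trans (integral_ckernel_le z) (ltry _).
Qed.

Lemma potential_integrable f z : cmeas f -> (potential f z < +oo)%E ->
  mu.-integrable setT (fun xi => (sqn (f xi) * ckernel z xi)%:E).
Proof.
move=> mf foo; apply/integrableP; split.
  apply/measurable_EFinP; apply: measurable_funM; first exact: measurable_sqn.
  exact: measurable_ckernel1.
by under eq_integral do rewrite gee0_abs ?lee_fin ?mulr_ge0 ?sqn_ge0 ?ckernel_ge0//.
Qed.

Lemma AMGM_weighted (x s k t : R) : 0 < t -> 0 <= k -> 0 <= s -> x ^+ 2 <= s * k ^+ 2 ->
  2 * `|x| <= t * (s * k) + t^-1 * k.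
Proof.
move=> t0 k0 s0 xs.
have xle : `|x| <= Num.sqrt s * k.
  rewrite -[X in _ <= _ * X]ger0_norm// -!sqrtr_sqr -sqrtrM//.
  exact: ler_wsqrtr.
apply: le_trans (_ : 2 * (Num.sqrt s * k) <= _); first by rewrite ler_wpM2l.
rewrite -{2}(sqr_sqrtr s0); set a := Num.sqrt s.
have h : 0 <= t^-1 * k * (t * a - 1) ^+ 2 
  by apply: mulr_ge0; [rewrite mulr_ge0 ?invr_ge0 ?(ltW t0)|exact: sqr_ge0].
have : t^-1 * k * (t * a - 1) ^+ 2 = t * (a ^+ 2 * k) - 2 * (a * k) + t^-1 * k.
  by field; rewrite gt_eqF.
by lra.
Qed.

Lemma sqr_le_of_AMGM (U A k : R) : 0 <= U -> 0 <= A -> 0 < k ->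
  (forall t, 0 < t -> 2 * U <= t * A + t^-1 * k) -> U ^+ 2 <= k * A.
Proof.
move=> U0 A0 k0 H; have [->|Un0] := eqVneq U 0; first by rewrite expr0n/= mulr_ge0 ?(ltW k0).
have Up : 0 < U by rewrite lt_def Un0.
have := H (k / U) (divr_gt0 k0 Up).
have -> : (k / U)^-1 * k = U by field; rewrite Un0 gt_eqF.
rewrite (_ : 2 * U = U + U) ?lerD2r; last by ring.
by rewrite -mulrAC -ler_pdivrMr ?invr_gt0// invrK expr2.
Qed.

Lemma cintegrand_part f z (pr : R[i] -> R) : (forall c, pr c ^+ 2 <= sqn c) ->
  cmeas f -> measurable_fun setT (fun xi => pr (cintegrand f z xi)) ->
  (potential f z < +oo)%E ->
  mu.-integrable setT (fun xi => (pr (cintegrand f z xi))%:E) /\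
  (\int[mu]_xi pr (cintegrand f z xi)) ^+ 2 <= K * fine (potential f z).
Proof.
move=> prle mf mpr foo.
have ik := ckernel_integrable z; have ip := potential_integrable mf foo.
have prk xi : pr (cintegrand f z xi) ^+ 2 <= sqn (f xi) * ckernel z xi ^+ 2.
  by rewrite -sqn_cintegrand.
have dom t xi : 0 < t -> 2 * `|pr (cintegrand f z xi)| <=
    t * (sqn (f xi) * ckernel z xi) + t^-1 * ckernel z xi.
  by move=> t0; apply: AMGM_weighted => //; rewrite ?ckernel_ge0 ?sqn_ge0.
have ipr : mu.-integrable setT (fun xi => (pr (cintegrand f z xi))%:E).
  apply: le_integrable (integrableD measurableT ip ik) => //; first exact/measurable_EFinP.
  move=> xi _ /=; rewrite lee_fin; apply: le_trans (ler_norm _).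
  have := dom 1 xi ltr01; rewrite invr1 !mul1r.
  have := normr_ge0 (pr (cintegrand f z xi)); lra.
split=> //.
have ia : mu.-integrable setT (EFin \o (fun xi => `|pr (cintegrand f z xi)|)).
  by have := integrable_abse ipr.
apply: (@le_trans _ _ ((\int[mu]_xi `|pr (cintegrand f z xi)|) ^+ 2)).
  rewrite -[X in X <= _]real_normK ?num_real// lerXn2r// ?nnegrE//.
    by apply: Rintegral_ge0 => xi _.
  exact: le_normr_Rintegral.
apply: sqr_le_of_AMGM.
- by apply: Rintegral_ge0 => xi _.
- exact/fine_ge0/potential_ge0.
- exact: ckernel_bound_gt0.
move=> t t0; rewrite -RintegralZl//.
have i1 : mu.-integrable setT (EFin \o (fun xi => t * (sqn (f xi) * ckernel z xi))).
  by have := integrableZl measurableT t ip; apply: eq_integrable => // xi _; rewrite /= -EFinM.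
have i2 : mu.-integrable setT (EFin \o (fun xi => t^-1 * ckernel z xi)).
  by have := integrableZl measurableT t^-1 ik; apply: eq_integrable => // xi _; rewrite /= -EFinM.
apply: (@le_trans _ _ (\int[mu]_xi (t * (sqn (f xi) * ckernel z xi) + t^-1 * ckernel z xi))).
  apply: le_Rintegral => //.
  - by have := integrableZl measurableT 2 ia; apply: eq_integrable => // xi _; rewrite /= -EFinM.
  - by have := integrableD measurableT i1 i2; apply: eq_integrable => // xi _; rewrite /= -EFinD.
  - by move=> xi _; exact: dom.
rewrite RintegralD// !RintegralZl// lerD2l ler_wpM2l ?invr_ge0 ?(ltW t0)//.
rewrite -lee_fin /Rintegral fineK; last exact: integrable_fin_num.
exact: integral_ckernel_le.
Qed.

Lemma cintegrand_integrable f z : cmeas f -> (potential f z < +oo)%E ->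
  cintegrable (cintegrand f z).
Proof.
move=> mf foo; have [m1 m2] := cmeas_cintegrand z mf; split.
  by have [] := @cintegrand_part f z (@complex.Re R) _ mf m1 foo => // c; rewrite lerDl sqr_ge0.
by have [] := @cintegrand_part f z (@complex.Im R) _ mf m2 foo => // c; rewrite lerDr sqr_ge0.
Qed.

Lemma piV_sqr_le1 : (pi^-1 : R) ^+ 2 <= 1.
Proof.
rewrite exprn_ile1// ?invr_ge0 ?pi_ge0// invf_le1 ?pi_gt0//.
by apply: le_trans (pi_ge2 R); rewrite ler1n.
Qed.

Lemma sqn_cauchy_le f z : cmeas f ->
  ((sqn (Defs.cauchy f z))%:E <= (2 * K)%:E * potential f z)%E.
Proof.
move=> mf; have K0 := ckernel_bound_gt0 R.
have [foo|] := ltP (potential f z) +oo%E; last first.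
  by rewrite leye_eq => /eqP ->; rewrite gt0_muley ?leey// lte_fin mulr_gt0.
have [m1 m2] := cmeas_cintegrand z mf.
have [|_ h1] := @cintegrand_part f z (@complex.Re R) _ mf m1 foo.
  by move=> c; rewrite lerDl sqr_ge0.
have [|_ h2] := @cintegrand_part f z (@complex.Im R) _ mf m2 foo.
  by move=> c; rewrite lerDr sqr_ge0.
rewrite -(@fineK _ (potential f z)) ?ge0_fin_numE ?potential_ge0// -EFinM lee_fin.
rewrite /Defs.cauchy sqnM {1}/sqn/= expr0n/= addr0.
apply: (@le_trans _ _ (1 * sqn (cintegral (cintegrand f z)))).
  by rewrite ler_wpM2r ?sqn_ge0// piV_sqr_le1.
by rewrite mul1r /sqn/=; lra.
Qed.

Lemma integral_potential_le f : cmeas f ->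
  (\int[mu]_z potential f z <= K%:E * \int[mu]_z (sqn (f z))%:E)%E.
Proof.
move=> mf; rewrite /potential.
rewrite (fubini_tonelli (fun u : plane R * plane R =>
   (sqn (f u.2) * ckernel u.1 u.2)%:E)); last 2 first.
- apply/measurable_EFinP; apply: measurable_funM; last exact: measurable_ckernel.
  exact: (measurableT_comp (measurable_sqn mf) measurable_snd).
- by move=> u; rewrite lee_fin mulr_ge0 ?sqn_ge0 ?ckernel_ge0.
have msq : measurable_fun setT (fun z => (sqn (f z))%:E).
  by apply/measurable_EFinP; exact: measurable_sqn.
rewrite -ge0_integralZl//; last 2 first.
- by move=> z _; rewrite lee_fin sqn_ge0.
- by rewrite lee_fin ltW// ckernel_bound_gt0.
apply: ge0_le_integral => //.
- by move=> xi _; apply: integral_ge0 => z _; rewrite lee_fin mulr_ge0 ?sqn_ge0 ?ckernel_ge0.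
- apply: (measurable_fun_fubini_tonelli_G (m1 := mu)
    (fun u : plane R * plane R => (sqn (f u.2) * ckernel u.1 u.2)%:E)).
    apply/measurable_EFinP; apply: measurable_funM; last exact: measurable_ckernel.
    exact: (measurableT_comp (measurable_sqn mf) measurable_snd).
  by move=> u; rewrite lee_fin mulr_ge0 ?sqn_ge0 ?ckernel_ge0.
- exact: emeasurable_funM.
move=> xi _ /=; under eq_integral do rewrite EFinM ckernelC.
rewrite ge0_integralZl//; last 3 first.
- by apply/measurable_EFinP; exact: measurable_ckernel1.
- by move=> z _; rewrite lee_fin ckernel_ge0.
- by rewrite lee_fin sqn_ge0.
rewrite muleC lee_wpmul2r// ?lee_fin ?sqn_ge0//.
exact: integral_ckernel_le.
Qed.

Lemma measurable_potential f : cmeas f -> measurable_fun setT (potential f).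
Proof.
move=> mf; apply: (measurable_fun_fubini_tonelli_F (m2 := mu)
  (fun u : plane R * plane R => (sqn (f u.2) * ckernel u.1 u.2)%:E)).
  apply/measurable_EFinP; apply: measurable_funM; last exact: measurable_ckernel.
  exact: (measurableT_comp (measurable_sqn mf) measurable_snd).
by move=> u; rewrite lee_fin mulr_ge0 ?sqn_ge0 ?ckernel_ge0.
Qed.

Lemma integral_sqn_cauchy_le f : cmeas f ->
  (\int[mu]_z (sqn (Defs.cauchy f z))%:E <=
   (2 * K ^+ 2)%:E * \int[mu]_z (sqn (f z))%:E)%E.
Proof.
move=> mf; have K0 := ckernel_bound_gt0 R.
apply: (@le_trans _ _ (\int[mu]_z ((2 * K)%:E * potential f z))%E).
  apply: ge0_le_integral => //.
  - by move=> z _; rewrite lee_fin sqn_ge0.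
  - by apply/measurable_EFinP; apply: measurable_sqn; exact: cmeas_cauchy.
  - by apply: emeasurable_funM => //; exact: measurable_potential.
  - by move=> z _; exact: sqn_cauchy_le.
rewrite ge0_integralZl//; last 3 first.
- exact: measurable_potential.
- by move=> z _; exact: potential_ge0.
- by rewrite lee_fin mulr_ge0 ?(ltW K0).
rewrite expr2 mulrA (EFinM (2 * K)) -muleA lee_pmul2l//; last by rewrite lte_fin mulr_gt0.
exact: integral_potential_le.
Qed.

Lemma cauchy_L2 f : L2 f -> L2 (Defs.cauchy f).
Proof.
move=> /L2P[mf foo]; apply/L2P; split; first exact: cmeas_cauchy.
apply: le_lt_trans (integral_sqn_cauchy_le mf) _; apply: lte_mul_pinfty => //.
by rewrite lee_fin mulr_ge0 ?sqr_ge0.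
Qed.

Lemma rip_cauchy_le f : L2 f ->
  rip (Defs.cauchy f) (Defs.cauchy f) <= 2 * K ^+ 2 * rip f f.
Proof.
move=> Lf; rewrite -lee_fin EFinM !rip_sqn//; last exact: cauchy_L2.
by apply: integral_sqn_cauchy_le; exact: L2_cmeas.
Qed.

Lemma ae_potential_lty f : L2 f -> {ae mu, forall z, (potential f z < +oo)%E}.
Proof.
move=> /L2P[mf foo]; have mp := measurable_potential mf.
have : mu.-integrable setT (potential f).
  apply/integrableP; split=> //.
  under eq_integral do rewrite gee0_abs ?potential_ge0//.
  apply: le_lt_trans (integral_potential_le mf) _; apply: lte_mul_pinfty => //.
  by rewrite lee_fin ltW// ckernel_bound_gt0.
move=> /(integrable_ae measurableT); apply: filterS => z /(_ I).
by rewrite ge0_fin_numE// potential_ge0.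
Qed.

Lemma cauchyD f g : L2 f -> L2 g ->
  {ae mu, forall z, Defs.cauchy (f + g) z = Defs.cauchy f z + Defs.cauchy g z}.
Proof.
move=> Lf Lg; move: (ae_potential_lty Lf) (ae_potential_lty Lg); apply: filterS2 => z pf pg.
have If := cintegrand_integrable (L2_cmeas Lf) pf.
have Ig := cintegrand_integrable (L2_cmeas Lg) pg.
rewrite /Defs.cauchy -mulrDr -cintegralD//.
by congr (_ * _); apply: eq_cintegral => xi; rewrite -mulrDl.
Qed.

Lemma cauchyZ c f : L2 f ->
  {ae mu, forall z, Defs.cauchy (fun z => c * f z) z = c * Defs.cauchy f z}.
Proof.
move=> Lf; move: (ae_potential_lty Lf); apply: filterS => z pf.
have If := cintegrand_integrable (L2_cmeas Lf) pf.
rewrite /Defs.cauchy [RHS]mulrCA; congr (_ * _); rewrite -cintegralZ//.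
by apply: eq_cintegral => xi; rewrite mulrA.
Qed.

(* Rotating by the unit [w] turns the kernel [1 / (z - xi)] into
   [w^-1 / (z - xi)]. *)
Lemma cauchy_turn f (chi : R[i]) : L2 f -> (forall z, f (turn z) = chi * f z) ->
  {ae mu, forall z, Defs.cauchy f (turn z) = chi / turn_unit R * Defs.cauchy f z}.
Proof.
move=> Lf fchi; move: (ae_potential_lty Lf); apply: filterS => z pf.
rewrite /Defs.cauchy [RHS]mulrCA; congr (_ * _).
have := cintegral_turn (cmeas_cintegrand (turn z) (L2_cmeas Lf)) => <-.
rewrite -cintegralZ; last exact: (cintegrand_integrable (L2_cmeas Lf) pf).
apply: eq_cintegral => xi; rewrite /cintegrand !toC_turn fchi -mulrBr invfM.
by rewrite mulrACA.
Qed.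

End cauchy_bound.

(** * Orthogonality of the weight spaces *)
Section weights.
Context (R : realType).
Local Notation mu := (@gauss R).
Local Notation w := (turn_unit R).
Implicit Types (f g r s : plane R -> R[i]) (z : plane R).

(* Modulo 5 one has [(3 + 4 i)^n = 3 + 4 i] for [n > 0], so the imaginary part
   never vanishes. *)
Lemma turn_unit_exprn_neq1 n : w ^+ n.+1 != 1.
Proof.
have [a [b ab]] : exists a b : int,
    w ^+ n.+1 * 5%:C ^+ n.+1 = (5 * a + 3)%:~R +i* (5 * b + 4)%:~R.
  elim: n => [|n [a [b IH]]].
    exists 0, 0; rewrite !expr1 !mulr0 !add0r; apply/eqP; rewrite eq_complex/=.
    by apply/andP; split; apply/eqP; field.
  exists (3 * a - 4 * b - 2), (4 * a + 3 * b + 4).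
  rewrite exprS (exprS 5%:C) mulrACA IH; apply/eqP; rewrite eq_complex Re_mulc Im_mulc.
  by apply/andP; split; apply/eqP; rewrite !(Re_mulc, Im_mulc)/=; field.
apply/eqP => w1; move: ab; rewrite w1 mul1r -rmorphXn => -[_ /esym/eqP].
rewrite intr_eq0 => /eqP; lia.
Qed.

Lemma turn_unitJ : (w^*)%R = w^-1.
Proof. by apply/eqP; rewrite eq_complex/=; apply/andP; split; apply/eqP; field. Qed.

Lemma turn_unit_neq0 : w != 0.
Proof. by rewrite eq_complex/= negb_and; apply/orP; left;
  rewrite mulf_neq0 ?invr_eq0 ?pnatr_eq0. Qed.

Lemma turn_unit_exprz_neq1 (n : int) : n != 0 -> w ^ n != 1.
Proof.
case: n => [[|n]|n] // _; first exact: turn_unit_exprn_neq1.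
by rewrite NegzE -exprnN invr_eq1 turn_unit_exprn_neq1.
Qed.

Lemma turn_unit_exprzJ (n : int) : ((w ^ n)^*)%R = w ^ (- n).
Proof. by rewrite fmorphXz/= turn_unitJ exprz_inv. Qed.

Definition weight_vector (l : int) f := L2 f /\
  {ae mu, forall z, f (turn z) = w ^ (- (l + 1)) * f z}.

Lemma ae_eq_cintegral (F G : plane R -> R[i]) : cmeas F -> cmeas G ->
  {ae mu, forall z, F z = G z} -> cintegral F = cintegral G.
Proof.
move=> [F1 F2] [G1 G2] FG; congr (_ +i* _); congr fine; apply: ae_eq_integral => //;
  try exact/measurable_EFinP.
  by move: FG; apply: filterS => z -> _.
by move: FG; apply: filterS => z -> _.
Qed.

Lemma cmeas_conj f : cmeas f -> cmeas (fun z => (f z)^*).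
Proof.
move=> [m1 m2]; split.
  by rewrite (_ : (fun z => _) = fun z => complex.Re (f z))//; apply/funext => z; case: (f z).
rewrite (_ : (fun z => _) = fun z => - complex.Im (f z)); first exact: measurable_funN.
by apply/funext => z; case: (f z).
Qed.

Lemma weight_inner_eq0 k l f g : weight_vector k f -> weight_vector l g -> k != l ->
  inner f g = 0.
Proof.
move=> [Lf wf] [Lg wg] kl; pose F z := f z * (g z)^*.
have mF : cmeas F by apply: cmeasM; [exact: L2_cmeas|apply/cmeas_conj; exact: L2_cmeas].
have iF : cintegrable F.
  split.
    have := redot_integrable Lf Lg; apply: eq_integrable => // z _.
    by rewrite /F /redot; case: (f z) => a b; case: (g z) => c d /=; congr (_%:E); ring.
  have := redot_integrable Lf (L2Z 'i Lg); apply: eq_integrable => // z _.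
  by rewrite /F /redot; case: (f z) => a b; case: (g z) => c d /=; congr (_%:E); ring.
have FT : {ae mu, forall z, F (turn z) = w ^ (l - k) * F z}.
  move: wf wg; apply: filterS2 => z fz gz.
  rewrite /F fz gz rmorphM/= mulrACA turn_unit_exprzJ opprK; congr (_ * _).
  by rewrite -expfzDr ?turn_unit_neq0//; congr (w ^ _); lia.
have mFT : cmeas (fun z => F (turn z)).
  by split; [exact: (measurableT_comp mF.1 (@measurable_turn R))|
             exact: (measurableT_comp mF.2 (@measurable_turn R))].
have eqF : inner f g = w ^ (l - k) * inner f g.
  rewrite -[in RHS]/(cintegral F) -cintegralZ// -[LHS]/(cintegral F) -cintegral_turn//.
  by apply: ae_eq_cintegral => //; apply: cmeasM => //; exact: cmeas_cst.
apply/eqP; apply: contraT => i0; move/eqP: eqF.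
rewrite -[X in X == _]mul1r (inj_eq (mulIf i0)) eq_sym (negPf (turn_unit_exprz_neq1 _))//.
by rewrite subr_eq0 eq_sym.
Qed.

Definition wpsi (l : int) (n : nat) : plane R -> R[i] :=
  if 0 <= l then @psi R n (n + `|l|) else psi (n + `|l|) n.

Lemma EspaceE l : @Espace R l = L2closure (Defs.span (wpsi l)).
Proof. by rewrite /Espace /Eplus /Eminus /wpsi; case: (0 <= l). Qed.

Lemma hermite_L2 m n : L2 (@hermite R m n).
Proof. exact/zpoly_L2/hermite_zpoly. Qed.

Lemma wpsi_L2 l n : L2 (wpsi l n).
Proof. by rewrite /wpsi; case: ifP => _; apply: cauchy_L2; exact: hermite_L2. Qed.

Lemma wpsi_weight l n : weight_vector l (wpsi l n).
Proof.
split; first exact: wpsi_L2.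
rewrite /wpsi /psi; case: ifPn => l0.
  have := cauchy_turn (hermite_L2 n (n + `|l|)) (hermite_turn n (n + `|l|)).
  apply: filterS => z ->; rewrite leq_addr addKn; congr (_ * _).
  rewrite -rmorphXn /= -[_ ^+ _]/(w ^ (`|l|%N : int)) turn_unit_exprzJ -exprN1.
  by rewrite -expfzDr ?turn_unit_neq0//; congr (w ^ _); lia.
have := cauchy_turn (hermite_L2 (n + `|l|) n) (hermite_turn (n + `|l|) n).
apply: filterS => z ->; rewrite leqNgt -{1}(addn0 n) ltn_add2l addKn.
rewrite absz_gt0 (_ : l != 0)/=; last by lia.
congr (_ * _); rewrite -[_ ^+ _]/(w ^ (`|l|%N : int)) -exprN1.
by rewrite -expfzDr ?turn_unit_neq0//; congr (w ^ _); lia.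
Qed.

End weights.

(** * Decomposition of the range *)
Section decomposition.
Context (R : realType).
Local Notation mu := (@gauss R).
Implicit Types (f g r s u v : plane R -> R[i]) (z : plane R).

Lemma spanZ (u : nat -> plane R -> R[i]) c f :
  Defs.span u f -> Defs.span u (fun z => c * f z).
Proof.
move=> [N [a ->]]; exists N, (fun n => c * a n); apply/funext => z.
by rewrite mulr_sumr; apply: eq_bigr => n _; rewrite mulrA.
Qed.

Lemma spanD (u : nat -> plane R -> R[i]) f g :
  Defs.span u f -> Defs.span u g -> Defs.span u (f + g).
Proof.
have widen N M (a : nat -> R[i]) z : (N <= M)%N -> \sum_(n < N) a n * u n z =
    \sum_(n < M) (if (n < N)%N then a n else 0) * u n z.
  move=> NM; rewrite (big_ord_widen M (fun n => a n * u n z) NM) big_mkcond/=.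
  by apply: eq_bigr => n _; case: ifP => _ //; rewrite mul0r.
move=> [N [a ->]] [M [b ->]]; exists (maxn N M).
exists (fun n => (if (n < N)%N then a n else 0) + (if (n < M)%N then b n else 0)).
apply/funext => z; rewrite fctE (widen N (maxn N M)) ?leq_maxl//.
rewrite (widen M (maxn N M)) ?leq_maxr// -big_split/=.
by apply: eq_bigr => n _; rewrite mulrDl.
Qed.

Lemma span0 (u : nat -> plane R -> R[i]) : Defs.span u 0.
Proof. by exists 0%N, (fun=> 0); apply/funext => z; rewrite big_ord0. Qed.

Lemma span_mem (u : nat -> plane R -> R[i]) n : Defs.span u (u n).
Proof.
exists n.+1, (fun k => (k == n)%:R); apply/funext => z.
rewrite big_ord_recr/= eqxx mul1r big1 ?add0r// => k _.
by rewrite (ltn_eqF (ltn_ord k)) mul0r.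
Qed.

Lemma span_ind (u : nat -> plane R -> R[i]) (P : set (plane R -> R[i])) :
  P 0 -> (forall f g, P f -> P g -> P (f + g)) ->
  (forall c n, P (fun z => c * u n z)) -> Defs.span u `<=` P.
Proof.
move=> P0 PD Pu _ [N [c ->]].
rewrite (_ : (fun z => _) = \sum_(n < N) (fun z => c n * u n z)).
  exact: (big_ind P).
by apply/funext => z; rewrite fct_sumE.
Qed.

Lemma span_L2 (u : nat -> plane R -> R[i]) : (forall n, L2 (u n)) -> Defs.span u `<=` @L2 R.
Proof.
move=> Lu; apply: span_ind; [exact: L20|exact: L2D|].
by move=> c n; exact: L2Z.
Qed.

Lemma wspan_L2 l : Defs.span (@wpsi R l) `<=` @L2 R.
Proof. by apply: span_L2 => n; exact: wpsi_L2. Qed.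

Lemma wspan_weight l f : Defs.span (@wpsi R l) f -> weight_vector l f.
Proof.
apply: span_ind => [|f1 f2 [L1 w1] [L2 w2]|c n].
- by split; [exact: L20|apply: nearW => z; rewrite mulr0].
- split; first exact: L2D.
  by move: w1 w2; apply: filterS2 => z h1 h2; rewrite !fctE h1 h2 mulrDr.
- have [L1 w1] := wpsi_weight R l n; split; first exact: L2Z.
  by move: w1; apply: filterS => z ->; rewrite mulrCA.
Qed.

Lemma Espace_L2 l f : Espace l f -> L2 f.
Proof. by rewrite EspaceE => -[]. Qed.

Lemma EspaceP l f : Espace l f <-> L2 f /\
  forall e, 0 < e -> exists2 s, Defs.span (@wpsi R l) s & rip (f - s) (f - s) < e.
Proof. by rewrite EspaceE; exact: L2closureP (@wspan_L2 l). Qed.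

Lemma rip_Espace_eq0 l r : L2 r -> (forall s, Defs.span (@wpsi R l) s -> rip r s = 0) ->
  forall f, Espace l f -> rip r f = 0.
Proof.
move=> Lr rs f /EspaceP[Lf fs]; apply: rip_limit_eq0 => // e e0.
by have [s Ss fse] := fs e e0; exists s; split=> //; [exact: wspan_L2 Ss|exact: rs].
Qed.

Lemma wspan_rip_eq0 k l f g : k != l -> Defs.span (@wpsi R k) f ->
  Defs.span (@wpsi R l) g -> rip f g = 0.
Proof.
move=> kl /wspan_weight wf /wspan_weight wg.
by have := weight_inner_eq0 wf wg kl; rewrite inner_rip => -[].
Qed.

Lemma Espace_rip_eq0 k l f g : k != l -> Espace k f -> Espace l g -> rip f g = 0.
Proof.
move=> kl Ef Eg; apply: (rip_Espace_eq0 (Espace_L2 Ef) _ Eg) => s Ss.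
rewrite ripC; apply: (rip_Espace_eq0 _ _ Ef); first exact: wspan_L2 Ss.
by move=> t St; rewrite ripC; exact: wspan_rip_eq0 St Ss.
Qed.

Lemma rip_mulI f : rip (fun z => 'i * f z) (fun z => 'i * f z) = rip f f.
Proof.
by apply: eq_Rintegral => z _; rewrite /redot; case: (f z) => a b /=; ring.
Qed.

Lemma Espace_mulI l f : Espace l f -> Espace l (fun z => 'i * f z).
Proof.
move=> /EspaceP[Lf fs]; apply/EspaceP; split; first exact: L2Z.
move=> e e0; have [s Ss fse] := fs e e0; exists (fun z => 'i * s z); first exact: spanZ.
rewrite (_ : _ - _ = fun z => 'i * (f - s) z) ?rip_mulI//.
by apply/funext => z; rewrite !fctE mulrBr.
Qed.

Lemma Espace_orthogonal : orthogonal_family (@Espace R).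
Proof.
move=> k l kl f g Ef Eg; rewrite inner_rip.
by rewrite (Espace_rip_eq0 kl Ef Eg) (Espace_rip_eq0 kl Ef (Espace_mulI Eg)).
Qed.

Lemma cauchy_range_L2 : @cauchy_range R `<=` @L2 R.
Proof. by move=> f []. Qed.

Lemma cauchy_rangeD f g : cauchy_range f -> cauchy_range g -> cauchy_range (f + g).
Proof.
move=> [Lf [f0 Lf0 ff0]] [Lg [g0 Lg0 gg0]]; split; first exact: L2D.
exists (f0 + g0); first exact: L2D.
near=> z; rewrite fctE.
have -> : f z = Defs.cauchy f0 z by near: z.
have -> : g z = Defs.cauchy g0 z by near: z.
by apply/esym; near: z; exact: cauchyD.
Unshelve. all: by end_near. Qed.

Lemma cauchy_rangeZ c f : cauchy_range f -> cauchy_range (fun z => c * f z).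
Proof.
move=> [Lf [f0 Lf0 ff0]]; split; first exact: L2Z.
exists (fun z => c * f0 z); first exact: L2Z.
by move: ff0 (cauchyZ c Lf0); apply: filterS2 => z -> ->.
Qed.

Lemma cauchy_range_cauchy f : L2 f -> cauchy_range (Defs.cauchy f).
Proof. by move=> Lf; split; [exact: cauchy_L2|exists f => //; exact: nearW]. Qed.

Lemma wspan_cauchy_range l : Defs.span (@wpsi R l) `<=` @cauchy_range R.
Proof.
have psi_range m n : cauchy_range (@psi R m n).
  by apply: cauchy_range_cauchy; exact: hermite_L2.
apply: span_ind => [|f g|c n]; [|exact: cauchy_rangeD|].
  have := cauchy_rangeZ 0 (psi_range 0%N 0%N).
  by rewrite (_ : (fun z => _) = 0)//; apply/funext => z; rewrite mul0r.
by apply: cauchy_rangeZ; rewrite /wpsi; case: ifP.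
Qed.

Lemma closure_range0 : L2closure (@cauchy_range R) 0.
Proof.
apply/(L2closureP _ cauchy_range_L2); split; first exact: L20.
move=> e e0; exists 0; first exact: (wspan_cauchy_range (span0 (wpsi 0))).
by rewrite subr0 (ae_eq0_rip (L20 R))//; exact: nearW.
Qed.

Lemma closure_rangeD f g : L2closure (@cauchy_range R) f ->
  L2closure (@cauchy_range R) g -> L2closure (@cauchy_range R) (f + g).
Proof.
move=> /(L2closureP _ cauchy_range_L2)[Lf fS] /(L2closureP _ cauchy_range_L2)[Lg gS].
apply/(L2closureP _ cauchy_range_L2); split; first exact: L2D.
move=> e e0; have e4 : 0 < e / 4 by rewrite divr_gt0.
have [f' Rf f'e] := fS _ e4; have [g' Rg g'e] := gS _ e4.
exists (f' + g'); first exact: cauchy_rangeD.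
rewrite opprD addrACA; apply: le_lt_trans (rip_sqrD_le _ _) _.
- by apply: L2B => //; exact: cauchy_range_L2.
- by apply: L2B => //; exact: cauchy_range_L2.
- lra.
Qed.

Lemma Espace_closure_range l f : Espace l f -> L2closure (@cauchy_range R) f.
Proof.
move=> /EspaceP[Lf fs]; apply/(L2closureP _ cauchy_range_L2); split=> // e e0.
by have [s Ss fse] := fs e e0; exists s => //; exact: wspan_cauchy_range Ss.
Qed.

Lemma closure_range_limit f : L2 f ->
  (forall e, 0 < e -> exists2 g, L2closure (@cauchy_range R) g & rip (f - g) (f - g) < e) ->
  L2closure (@cauchy_range R) f.
Proof.
move=> Lf H; apply/(L2closureP _ cauchy_range_L2); split=> // e e0.
have e4 : 0 < e / 4 by rewrite divr_gt0.
have [g /(L2closureP _ cauchy_range_L2)[Lg gS] fge] := H _ e4.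
have [h Rh ghe] := gS _ e4; have Lh := cauchy_range_L2 Rh; exists h => //.
have -> : f - h = (f - g) + (g - h) by rewrite addrA subrK.
by apply: le_lt_trans (rip_sqrD_le (L2B Lf Lg) (L2B Lg Lh)) _; lra.
Qed.

Lemma hilbert_sum_sub : hilbert_sum (@Espace R) `<=` L2closure (@cauchy_range R).
Proof.
move=> f [Lf [u Eu fu]]; apply: closure_range_limit => // e e0.
have [F0 HF] := fu (Num.sqrt e) (ltac:(by rewrite sqrtr_gt0)).
have := HF F0 (fsubset_refl _).
have SE : L2closure (@cauchy_range R) (\sum_(l <- F0) u l).
  apply: (big_ind (L2closure (@cauchy_range R))); [exact: closure_range0|exact: closure_rangeD|].
  by move=> l _; exact: Espace_closure_range (Eu l).
rewrite (_ : (fun z => _) = f - \sum_(l <- F0) u l); last first.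
  by apply/funext => z; rewrite !fctE fct_sumE.
rewrite norm2_lt ?sqrtr_gt0//; last by apply: L2B => //; case: SE.
by rewrite sqr_sqrtr ?ltW// => h; exists (\sum_(l <- F0) u l).
Qed.

Lemma rip_ae_eqr r f g : L2 r -> L2 f -> L2 g ->
  {ae mu, forall z, f z = g z} -> rip r f = rip r g.
Proof.
move=> Lr Lf Lg fg; have L := L2B Lf Lg.
have fg0 : rip (f - g) (f - g) = 0.
  by apply: ae_eq0_rip => //; move: fg; apply: filterS => z fgz; rewrite !fctE fgz subrr.
have := rip_CauchySchwarz Lr L; rewrite fg0 mulr0 => h.
have : rip r (f - g) = 0 by apply/eqP; rewrite -sqrf_eq0 eq_le h sqr_ge0.
rewrite ripC ripD//; last exact: L2N.
by rewrite ripN// !(ripC _ r) => /eqP; rewrite subr_eq0 => /eqP.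
Qed.

(* Dual form of: [v] lies in the closed sum of finitely many of the [E_l]. *)
Definition finitely_supported v := exists F0 : {fset int}, forall F : {fset int},
  (F0 `<=` F)%fset -> forall r, L2 r ->
  (forall l, l \in F -> forall s, Defs.span (@wpsi R l) s -> rip r s = 0) -> rip r v = 0.

Lemma psi_wpsi m n : exists l k, @psi R m n = wpsi l k.
Proof.
have [mn|nm] := leqP m n.
  exists (n - m)%N%:Z, m; rewrite /wpsi /=.
  by rewrite subnKC.
exists (- (m - n)%N%:Z), n; rewrite /wpsi.
have -> : (0 <= - (m - n)%N%:Z) = false by lia.
by rewrite abszN absz_nat subnKC// ltnW.
Qed.

Lemma hspan_L2 p : hspan p -> L2 (p : plane R -> R[i]).
Proof.
elim=> [c m n|p1 p2 _ L1 _ L2']; last exact: L2D.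
by apply: L2Z; exact: hermite_L2.
Qed.

Lemma cauchy_hspan p : hspan p -> finitely_supported (Defs.cauchy p).
Proof.
elim=> [c m n|p1 p2 h1 [F1 H1] h2 [F2 H2]].
  have [l [k psiE]] := psi_wpsi m n.
  exists [fset l]%fset => F lF r Lr rF.
  have Lh := hermite_L2 R m n.
  rewrite (rip_ae_eqr Lr _ _ (cauchyZ c Lh)).
  - rewrite -/(psi m n) psiE; apply: (rF l); last exact/spanZ/span_mem.
    by move/fsubsetP: lF; apply; rewrite in_fset1.
  - by apply: cauchy_L2; exact: L2Z.
  - by apply: L2Z; exact: cauchy_L2.
exists (F1 `|` F2)%fset => F F12 r Lr rF.
have L1 := cauchy_L2 (hspan_L2 h1); have L2' := cauchy_L2 (hspan_L2 h2).
have C := cauchyD (hspan_L2 h1) (hspan_L2 h2).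
rewrite (rip_ae_eqr (g := Defs.cauchy p1 + Defs.cauchy p2) Lr)//.
- rewrite ripC ripD// !(ripC _ r) (H1 F) ?(H2 F) ?addr0//.
    exact: fsubset_trans (fsubsetUr _ _) F12.
  exact: fsubset_trans (fsubsetUl _ _) F12.
- by apply: cauchy_L2; apply: L2D; exact: hspan_L2.
- exact: L2D.
Qed.

Lemma range_approximation g (e : R) : L2closure (@cauchy_range R) g -> 0 < e ->
  exists v, [/\ L2 v, finitely_supported v & rip (g - v) (g - v) < e].
Proof.
move=> /(L2closureP _ cauchy_range_L2)[Lg gR] e0.
have e4 : 0 < e / 4 by rewrite divr_gt0.
have [h [Lh [f Lf hf]] ghe] := gR _ e4.
have K0 : 0 < 2 * ckernel_bound R ^+ 2 by rewrite mulr_gt0// exprn_gt0// ckernel_bound_gt0.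
have [p zp fpe] := zpoly_dense Lf (divr_gt0 e4 K0).
have Lp := zpoly_L2 zp; have LC := cauchy_L2 Lp.
exists (Defs.cauchy p); split=> //; first exact/cauchy_hspan/zpoly_hspan.
have -> : g - Defs.cauchy p = (g - h) + (h - Defs.cauchy p) by rewrite addrA subrK.
apply: le_lt_trans (rip_sqrD_le (L2B Lg Lh) (L2B Lh LC)) _.
suff : rip (h - Defs.cauchy p) (h - Defs.cauchy p) < e / 4 by lra.
have Lfp := L2B Lf Lp.
have hC : {ae mu, forall z, (h - Defs.cauchy p) z = Defs.cauchy (f - p) z}.
  move: hf (cauchyD Lfp Lp); apply: filterS2 => z hz; rewrite subrK => fz.
  by rewrite !fctE hz fz addrK.
rewrite (rip_ae_eqr _ _ _ hC); [|exact: L2B|exact: L2B|exact: cauchy_L2].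
rewrite ripC (rip_ae_eqr _ _ _ hC); [|exact: cauchy_L2|exact: L2B|exact: cauchy_L2].
apply: le_lt_trans (rip_cauchy_le Lfp) _.
by rewrite mulrC -ltr_pdivlMr.
Qed.

Lemma rip_sum (I : Type) (F : seq I) (u : I -> plane R -> R[i]) s :
  (forall i, L2 (u i)) -> L2 s -> rip (\sum_(i <- F) u i) s = \sum_(i <- F) rip (u i) s.
Proof.
move=> Lu Ls; elim: F => [|i F IH].
  rewrite !big_nil; have := ripN (L20 R) Ls; rewrite oppr0; lra.
rewrite !big_cons ripD ?IH//.
by apply: (big_ind (@L2 R)) => // [|f g]; [exact: L20|exact: L2D].
Qed.

Lemma closure_range_sub : L2closure (@cauchy_range R) `<=` hilbert_sum (@Espace R).
Proof.
move=> g gR; have Lg : L2 g by case: gR.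
have /choice[u uP] : forall l, exists p, Espace l p /\
    forall s, Defs.span (@wpsi R l) s -> rip (g - p) s = 0.
  move=> l; have [p pS gp] := L2_projection (span0 (wpsi l)) (@wspan_L2 l)
    (@spanD (wpsi l)) (fun a f => @spanZ (wpsi l) a%:C f) Lg.
  by exists p; rewrite EspaceE.
have Eu l : Espace l (u l) by have [] := uP l.
have Lu l : L2 (u l) by exact: Espace_L2 (Eu l).
split=> //; exists u => // e e0.
have [v [Lv [F0 HF0] gve]] := range_approximation gR (exprn_gt0 2 e0).
exists F0 => F F0F.
have LS : L2 (\sum_(l <- F) u l).
  by apply: (big_ind (@L2 R)) => // [|f f']; [exact: L20|exact: L2D].
pose r := g - \sum_(l <- F) u l; have Lr : L2 r by exact: L2B.
have r_orth l : l \in F -> forall s, Defs.span (@wpsi R l) s -> rip r s = 0.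
  move=> lF s Ss; have Ls := wspan_L2 Ss.
  rewrite /r ripD ?ripN//; last exact: L2N.
  rewrite rip_sum// (bigD1_seq l)/= ?fset_uniq// big1 ?addr0.
    by have [_ /(_ _ Ss)] := uP l; rewrite ripD ?ripN//; exact: L2N.
  move=> k kl; apply: (Espace_rip_eq0 kl (Eu k)).
  apply/EspaceP; split=> // e' e'0; exists s => //.
  by rewrite subrr (ae_eq0_rip (L20 R))//; exact: nearW.
have rv : rip r v = 0 by exact: HF0 r_orth.
have rS : rip r (\sum_(l <- F) u l) = 0.
  rewrite ripC rip_sum// big_seq big1// => l lF; rewrite ripC.
  by apply: (rip_Espace_eq0 Lr (r_orth l lF)).
have rr : rip r r = rip r (g - v).
  have -> : rip r (g - v) = rip r g.
    by rewrite ripC ripD ?ripN// ?(ripC _ r) ?rv ?oppr0 ?addr0//; exact: L2N.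
  rewrite {2}/r ripC ripD ?ripN//; last exact: L2N.
  by rewrite !(ripC _ r) rS oppr0 addr0.
have CS := rip_CauchySchwarz Lr (L2B Lg Lv).
rewrite (_ : (fun z => _) = r); last first.
  by apply/funext => z; rewrite /r !fctE fct_sumE.
rewrite norm2_lt//; apply: le_lt_trans gve.
have [->|r0] := eqVneq (rip r r) 0; first exact: rip_ge0.
move: CS; rewrite -rr expr2 ler_pM2l// lt_def r0; exact: rip_ge0.
Qed.

End decomposition.

Theorem theorem3p4 (R : realType) :
  orthogonal_family (@Espace R) /\
  L2closure (@cauchy_range R) = hilbert_sum (@Espace R).
Proof.
split; first exact: Espace_orthogonal.
by apply/seteqP; split; [exact: closure_range_sub|exact: hilbert_sum_sub].
Qed.
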